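(* Let $n\ge 3$ and let $K$ be a connected multi-crossing projection (of a link) all of whose crossings are $n$-crossings, with $c_n$ crossings. Let $s_{max}$ be a maximal state and $s_{min}$ a minimal state of this projection. Then $$|s_{max}|+|s_{min}|\le (2n-4)c_n+2 .$$
   Context: An $n$-crossing is a point of a link projection at which $n$ strands cross, each bisecting the crossing; locally it consists of $n$ distinct diameters of a disk, joining antipodal pairs among $2n$ equally spaced boundary points, at pairwise distinct heights. An $n$-split is a crossingless perfect matching of the $2n$ boundary points by $n$ disjoint arcs in the disk (up to isotopy). A-splits and B-splits: at a double crossing, the two regions swept out by rotating the overstrand counterclockwise until it meets the understrand are the A-regions; the A-split joins the two A-regions and has coefficient $A$; the B-split joins the other two regions and has coefficient $A^{-1}$. The $n$-skein relation of an $n$-crossing is the formal sum of $n$-splits with coefficients in $\mathbb Z[A^{\pm1}]$ defined recursively: a single strand ($n=1$) has the relation consisting of one arc with coefficient $A^0$. If $x'$ is an $(n+1)$-crossing, let $O$ be its top strand and $x$ the $n$-crossing obtained by deleting $O$. For each term in the $n$-skein relation of $x$, lay $O$ as an overstrand over its split (as a diameter meeting exactly the arcs whose endpoints it separates, each once), and resolve the resulting double crossings in all possible combinations of A-splits and B-splits, multiplying the coefficient by $A$ for each A-split and by $A^{-1}$ for each B-split. The sum of everything so obtained is the $(n+1)$-skein relation of $x'$. A term $S$ of the relation is a split together with a coefficient $JA^t$ ($J,t$ integers, $J\neq 0$); its power is $P(S)=t$. A split move on a split replaces two adjacent arcs by the only other two arcs connecting their four endpoints without creating crossings. For terms $S,T$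 of a given $n$-skein relation write $S\prec T$ if their splits are related by one split move and $P(S)=P(T)-2$; let $<$ be the transitive closure of $\prec$. A high split (resp. low split) is a split appearing in a term that is maximal (resp. minimal) for $<$. A state $s$ of an $n$-crossing projection is a choice, at each crossing, of a term of its $n$-skein relation, the crossing being replaced by the split of that term; $|s|$ is the number of resulting disjoint circles. The state contributes to the bracket polynomial the summand given by the product of the chosen coefficients times $(-A^2-A^{-2})^{|s|-1}$. A maximal state $s_{max}$ is a state all of whose splits are high splits and whose summand has the highest power of $A$ among the summands of all states. A minimal state $s_{min}$ is a state all of whose splits are low splits and whose summand has the lowest power of $A$ among the summands of all states. A projection is connected if it is a connected subset of the plane. *)

(* Defs.v *)
From HB Require Import structures.
From mathcomp Require Import all_boot all_order all_algebra all_fingroup.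
From Stdlib Require Import Relation_Operators.

Set Implicit Arguments.
Unset Strict Implicit.
Unset Printing Implicit Defensive.

Import Order.TTheory GRing.Theory Num.Theory.

(* Points 0, ..., 2n-1 are placed counterclockwise on the boundary of the
   disk; strand i of an n-crossing is the diameter joining i to i + n. *)
Notation point n := 'I_(n + n).
Definition strand_src n (o : 'I_n) : point n := lshift n o.
Definition strand_tgt n (o : 'I_n) : point n := rshift n o.

(* A system of arcs joining points to points. While a crossing is being
   built strand by strand, the unused points are fixed points. *)
Notation pairing n := {ffun point n -> point n}.

Definition is_split n (f : pairing n) : bool :=
  [&& [forall a : point n, f (f a) == a],
      [forall a : point n, f a != a] &
      [forall a : point n, forall b : point n, ~~ [&& a < b, b < f a & f a < f b]]].

Definition nsplit n := {f : pairing n | is_split f}.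

(* Adding an overstrand and resolving the double crossings. *)

(* Exactly one endpoint of an arc met by the overstrand o lies strictly
   between o and o + n. The arcs met are nested, so these endpoints in
   increasing order list the arcs in the order in which they are met when
   travelling along the overstrand from o to o + n. *)
Definition crossed n (o : 'I_n) (f : pairing n) : seq (point n) :=
  [seq x : point n <- enum (point n) |
     (strand_src o < x < strand_tgt o)
     && ~~ (strand_src o < f x < strand_tgt o)].

Definition join n (a b : point n) (g : pairing n) : pairing n :=
  [ffun x => if x == a then b else if x == b then a else g x].

(* [start] is the boundary point from which one arrives, along the current
   piece of the overstrand, at the next double crossing; [x] is the endpoint
   of the understrand on the right and [f x] the one on the left. Rotating
   the overstrand counterclockwise sweeps the back-right and the front-left
   regions; the A-split (true) joins them, hence connects the back half of
   the overstrand to [f x] and its front half to [x]. *)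
Fixpoint resolve_from n (f : pairing n) (start finish : point n)
    (xs : seq (point n * bool)) : pairing n :=
  match xs with
  | [::] => join start finish f
  | (x, isA) :: xs' =>
      join start (if isA then f x else x)
        (resolve_from f (if isA then x else f x) finish xs')
  end.

Definition resolve n (o : 'I_n) (f : pairing n) (e : seq bool) : pairing n :=
  resolve_from f (strand_src o) (strand_tgt o) (zip (crossed o f) e).

Definition weight (e : seq bool) : int :=
  (\sum_(isA <- e) (if isA then 1 else -1))%R.

(* [skein os g t] is the coefficient of A^t in the Laurent polynomial
   multiplying g in the skein relation of the crossing with strands os, listed
   from top to bottom. The recursion starts at the empty crossing; a single
   strand meets nothing, so its relation is one arc with coefficient A^0. *)
Fixpoint skein n (os : seq 'I_n) (g : pairing n) (t : int) : int :=
  (match os with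
   | [::] => ((g == [ffun a => a]) && (t == 0))%:R
   | o :: os' =>
       \sum_(f : pairing n)
         \sum_(e : (size (crossed o f)).-tuple bool | resolve o f e == g)
           skein os' f (t - weight e)
   end)%R.

(* An n-crossing is given by the heights of its strands, 0 being the lowest. *)
Notation ncrossing n := {perm 'I_n}.

Definition top_down n (h : ncrossing n) : seq 'I_n :=
  rev [seq (h^-1)%g k | k <- enum 'I_n].

(* The pair (S, t) stands for the split S with coefficient J A^t. *)
Notation term n := (nsplit n * int)%type.

Definition coef n (h : ncrossing n) (S : term n) : int :=
  skein (top_down h) (val S.1) S.2.

Definition is_term n (h : ncrossing n) (S : term n) : Prop :=
  coef h S <> 0%R.

Definition between n (a b x : point n) : bool := minn a b < x < maxn a b.

(* No third arc separates the arc at a from the arc at b. *)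
Definition adjacent n (f : pairing n) (a b : point n) : bool :=
  [forall c : point n, (c \notin [:: a; f a; b; f b]) ==>
     (between c (f c) a == between c (f c) b)].

(* T being crossingless, T <> S leaves a single way to reconnect the four
   endpoints a, f a, b, f b. *)
Definition split_move n (S T : nsplit n) : bool :=
  let f := val S in let g := val T in
  [exists a : point n, exists b : point n,
     [&& b != a, b != f a, adjacent f a b,
         [forall x : point n, (x \notin [:: a; f a; b; f b]) ==> (g x == f x)] &
         g != f]].

Definition term_prec n (h : ncrossing n) (S T : term n) : Prop :=
  [/\ is_term h S, is_term h T, split_move S.1 T.1 & S.2 = (T.2 - 2)%R].

Definition term_lt n (h : ncrossing n) : term n -> term n -> Prop :=
  clos_trans (term n) (@term_prec n h).

Definition high_split n (h : ncrossing n) (S : nsplit n) : Prop :=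
  exists t : int,
    is_term h (S, t) /\ ~ (exists T : term n, term_lt h (S, t) T).

Definition low_split n (h : ncrossing n) (S : nsplit n) : Prop :=
  exists t : int,
    is_term h (S, t) /\ ~ (exists T : term n, term_lt h T (S, t)).

(* Projections are encoded as planar combinatorial maps with darts (c, a), a
   being a boundary point of the disk around the crossing c. Circles without
   crossings have no dart and are only counted. *)
Notation dart n C := (C * point n)%type.

Definition next_face n (C : finType) (edge : dart n C -> dart n C)
    (d : dart n C) : dart n C :=
  ((edge d).1, ordS (edge d).2).

Definition map_adj n (C : finType) (edge : dart n C -> dart n C) :
    rel (dart n C) :=
  fun d d' => (d' == edge d) || (d'.1 == d.1).

Definition map_components n (C : finType) (edge : dart n C -> dart n C) : nat :=
  n_comp (map_adj edge) predT.

Record projection (n : nat) := Projection {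
  crossing : finType;
  height : crossing -> ncrossing n;
  edge : dart n crossing -> dart n crossing;
  edgeK : involutive edge;
  edge_neq : forall d, edge d != d;
  (* Euler's formula: V + F = E + 2 (number of components) *)
  planar : #|crossing| + fcard (next_face edge) predT
           = n * #|crossing| + 2 * map_components edge;
  free_circles : nat
}.

Definition connected n (K : projection n) : Prop :=
  map_components (@edge n K) + free_circles K = 1.

Section States.
Variables (n : nat) (K : projection n).
Implicit Types s : crossing K -> term n.

Definition is_state s : Prop := forall c, is_term (height c) (s c).

Definition state_adj s : rel (dart n (crossing K)) :=
  fun d d' => (d' == edge d) || (d' == (d.1, val (s d.1).1 d.2)).

Definition circles s : nat := n_comp (state_adj s) predT + free_circles K.

(* Laurent polynomials are handled inside the field of fractions of Z[A]. *)
Definition varA : {fraction {poly int}} := tofrac 'X%R.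

Definition summand s : {fraction {poly int}} :=
  ((\prod_(c : crossing K) ((coef (height c) (s c))%:~R * varA ^ (s c).2))
   * (- varA ^ 2 - varA ^ (-2)) ^+ (circles s).-1)%R.

Definition highest_power (u : {fraction {poly int}}) (d : int) : Prop :=
  exists (m : int) (p : {poly int}),
    [/\ p <> 0%R, u = (varA ^ m * tofrac p)%R & d = (m + (size p).-1%:Z)%R].

Definition lowest_power (u : {fraction {poly int}}) (d : int) : Prop :=
  exists (m : int) (p : {poly int}),
    [/\ (p`_0 <> 0)%R, u = (varA ^ m * tofrac p)%R & d = m].

Definition maximal_state s : Prop :=
  [/\ is_state s,
      forall c, high_split (height c) (s c).1 &
      exists2 d, highest_power (summand s) d &
        forall s' d', is_state s' -> highest_power (summand s') d' ->
          (d' <= d)%R].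

Definition minimal_state s : Prop :=
  [/\ is_state s,
      forall c, low_split (height c) (s c).1 &
      exists2 d, lowest_power (summand s) d &
        forall s' d', is_state s' -> lowest_power (summand s') d' ->
          (d <= d')%R].

End States.

(* Main.v *)
(** The coefficients of a skein relation are nonnegative, so its terms are exactly
    the outcomes of the successive A/B choices. Changing one choice along the top
    strand O is a split move that changes the power by 2; hence a maximal term is
    an all-A resolution, and a minimal term an all-B resolution, of O laid over a
    split of the lower strands. If O meets at most one arc of that split, then a
    split move below O that raises (lowers) the power lifts to one above it. By
    induction on the number of strands, for n >= 3 a high split and a low split
    are neither equal nor one split move apart; they differ at more than four
    boundary points, so their union consists of at most n - 2 closed curves.

    The edges, the splits of s_max and the splits of s_min are three
    fixed-point-free involutions of the 2nc darts: a 3-edge-coloured cubic graph,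
    hence a triangulated closed surface. Let l <= (n - 2)c be the number of curves
    of all the unions of splits and w the number of components of this graph.
    Since chi <= 2 on each component, |s_max| + |s_min| + l <= nc + 2w, and
    w <= 1 + l - c because the projection is connected. The bound on chi is proved
    by comparing ranks of spaces of functions over F_2 that are constant on
    components. *)
From HB Require Import structures.
From mathcomp Require Import all_boot all_order all_algebra all_fingroup.
From mathcomp Require Import zify.
From Stdlib Require Import Relation_Operators.
Require Import Defs.

Set Implicit Arguments.
Unset Strict Implicit.
Unset Printing Implicit Defensive.

Import Order.TTheory GRing.Theory Num.Theory.

(** * Noncrossing matchings *)

(** This is [between] on natural numbers: it tells on which side of the chord from a to b the
    boundary point x lies. Two chords with four distinct ends cross when one of them has the ends of
    the other on different sides. *)
Definition sep (a b x : nat) : bool := minn a b < x < maxn a b.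

Lemma sepC a b x : sep a b x = sep b a x.
Proof. by rewrite /sep minnC maxnC. Qed.

Lemma sepE a b x : a < b -> sep a b x = (a < x < b).
Proof. by move=> ab; rewrite /sep (minn_idPl (ltnW ab)) (maxn_idPr (ltnW ab)). Qed.

Lemma sepxx a x : sep a a x = false.
Proof. by rewrite /sep minnn maxnn; lia. Qed.

Lemma sepl a b : sep a b a = false.
Proof. by rewrite /sep; lia. Qed.

Lemma sepr a b : sep a b b = false.
Proof. by rewrite sepC sepl. Qed.

Lemma sep_symlt (a b x y : nat) : a < b -> x < y ->
  a != x -> a != y -> b != x -> b != y ->
  (a < x < b == (a < y < b)) = (x < a < y == (x < b < y)).
Proof.
move=> ab xy.
case: (ltngtP a x) => // ax _; case: (ltngtP a y) => // ay _;
case: (ltngtP b x) => // bx _; case: (ltngtP b y) => // b_y _; lia.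
Qed.

Lemma sep_sym (a b x y : nat) : a != b -> x != y ->
  a != x -> a != y -> b != x -> b != y ->
  (sep a b x == sep a b y) = (sep x y a == sep x y b).
Proof.
case: (ltngtP a b) => // ab _; case: (ltngtP x y) => // xy _ h1 h2 h3 h4.
- by rewrite !(sepE _ ab) !(sepE _ xy) sep_symlt.
- by rewrite !(sepC x) !(sepE _ ab) !(sepE _ xy) [LHS]eq_sym; apply: sep_symlt.
- by rewrite !(sepC a) !(sepE _ ab) !(sepE _ xy) [RHS]eq_sym; apply: sep_symlt.
- by rewrite !(sepC a) !(sepC x) !(sepE _ ab) !(sepE _ xy) [LHS]eq_sym [RHS]eq_sym; apply: sep_symlt.
Qed.

Lemma sep_crosslt (p q y z u v : nat) : u < v -> y < z ->
  y != u -> y != v -> z != u -> z != v ->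
  (y < p < z) != (y < q < z) ->
  (u < p < v) = (u < q < v) -> (u < y < v) = (u < z < v) -> (u < p < v) = (u < y < v).
Proof.
move=> uv yz; case: (ltngtP y u) => // yu _; case: (ltngtP y v) => // yv _;
case: (ltngtP z u) => // zu _; case: (ltngtP z v) => // zv _ /=; try lia.
all: try by move=> *; lia.
Qed.

(** The chords yz and pq meet, so a chord uv that crosses neither has both on the same side. *)
Lemma sep_cross (p q y z u v : nat) : u != v -> y != z ->
  y != u -> y != v -> z != u -> z != v -> sep y z p != sep y z q ->
  sep u v p = sep u v q -> sep u v y = sep u v z -> sep u v p = sep u v y.
Proof.
case: (ltngtP u v) => // uv _; case: (ltngtP y z) => // yz _ h1 h2 h3 h4.
- by rewrite !(sepE _ uv) !(sepE _ yz); apply: sep_crosslt.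
- by rewrite !(sepC y) !(sepE _ uv) !(sepE _ yz) => h5 h6 h7; rewrite h7; exact: (sep_crosslt uv yz h3 h4 h1 h2 h5 h6 (esym h7)).
- by rewrite !(sepC u) !(sepE _ uv) !(sepE _ yz); apply: sep_crosslt.
- by rewrite !(sepC y) !(sepC u) !(sepE _ uv) !(sepE _ yz) => h5 h6 h7; rewrite h7; exact: (sep_crosslt uv yz h4 h3 h2 h1 h5 h6 (esym h7)).
Qed.

(** The ends of the crossing chords yz and pq alternate on the circle, so p and y are neighbours
    among the four points. *)
Lemma sep_beyond (p q y z : nat) : y != z -> p != y ->
  y != q -> z != p -> z != q ->
  sep y z p != sep y z q -> sep p y z = sep p y q.
Proof.
move=> yz py yq zp zq.
have [lyz|lyz] : y < z \/ z < y by lia.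
  have [lpy|lpy] : p < y \/ y < p by lia.
    rewrite !(sepE _ lyz) !(sepE _ lpy); lia.
  rewrite !(sepC p) !(sepE _ lyz) !(sepE _ lpy); lia.
have [lpy|lpy] : p < y \/ y < p by lia.
  rewrite !(sepC y) !(sepE _ lyz) !(sepE _ lpy); lia.
rewrite !(sepC y) !(sepC p) !(sepE _ lyz) !(sepE _ lpy); lia.
Qed.

Opaque sep.

Lemma sep_swap m (a b x y : 'I_m) :
  a != b -> a != x -> a != y -> b != x -> b != y ->
  sep x y a = sep x y b -> sep a b x = sep a b y.
Proof.
move=> ab ax ay bx b_y h; have [->//|xy] := eqVneq x y.
by apply/eqP; rewrite (sep_sym ab xy ax ay bx b_y) h.
Qed.

(** At a fixed point a the chord is degenerate and [sep] is constantly false, so the boundary points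
    of strands not yet laid may be fixed. *)
Definition noncrossing n (f : pairing n) : Prop :=
  forall a b : point n, b != a -> b != f a -> sep a (f a) b = sep a (f a) (f b).

Definition matching n (f : pairing n) : Prop := involutive f /\ noncrossing f.

Lemma joinE n (a b : point n) g x :
  join a b g x = if x == a then b else if x == b then a else g x.
Proof. exact: ffunE. Qed.

Lemma join_matching n (f : pairing n) (p q : point n) :
  matching f -> f p = p -> f q = q -> p != q ->
  (forall b : point n, b != p -> b != q -> sep p q b = sep p q (f b)) ->
  matching (join p q f).
Proof.
move=> [fK ncf] fp fq pq H; split=> [u|a b].
  rewrite !joinE; case: (eqVneq u p) => [->|up]; first by rewrite eq_sym (negPf pq) eqxx.
  case: (eqVneq u q) => [->|uq]; first by rewrite eqxx.
  by rewrite -{1}fp -{2}fq !(can_eq fK) (negPf up) (negPf uq).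
have Hs a' : a' != p -> a' != q -> sep a' (f a') p = sep a' (f a') q.
  move=> ap aq; have [<-|afa] := eqVneq a' (f a'); first by rewrite !sepxx.
  have fap : f a' != p by rewrite (inv_eq fK) fp.
  have faq : f a' != q by rewrite (inv_eq fK) fq.
  exact: (sep_swap afa ap aq fap faq (H _ ap aq)).
rewrite !joinE; case: (eqVneq a p) => [->|ap].
  by move=> bp bq; rewrite (negPf bp) (negPf bq); apply: H.
case: (eqVneq a q) => [->|aq].
  by move=> bq bp; rewrite (negPf bp) (negPf bq) !(sepC q); apply: H.
case: (eqVneq b p) => [-> pa pfa|bp]; first exact: Hs.
by case: (eqVneq b q) => [-> qa qfa|bq]; [rewrite Hs | apply: ncf].
Qed.

(** The values of [f] are read only at the listed endpoints and at points that no [join] overwrites;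
    hence an arc that has been cut may be deleted from [f] when the rest of the overstrand is
    resolved. *)
Lemma resolve_from_eq n (f g : pairing n) xs p q u :
  {in unzip1 xs, f =1 g} -> [|| u == p, u == q | f u == g u] ->
  resolve_from f p q xs u = resolve_from g p q xs u.
Proof.
elim: xs p => [|[x isA] xs IH] p /= fg H; rewrite !joinE.
  by case: (u == p) H => //=; case: (u == q) => //= /eqP.
have -> : g x = f x by rewrite fg ?mem_head.
case: (eqVneq u p) => //= up; case: eqP => // _; apply: IH.
  by move=> v vxs; apply: fg; rewrite inE vxs orbT.
by move: H; rewrite (negPf up) /= => /orP[->|->]; rewrite !orbT.
Qed.

(** Cutting an arc at a double crossing frees its two ends, so the rest of the overstrand again runs
    between fixed points. *)
Definition del n (x : point n) (f : pairing n) : pairing n :=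
  [ffun u => if (u == x) || (u == f x) then u else f u].

Lemma delE n (x : point n) (f : pairing n) u :
  del x f u = if (u == x) || (u == f x) then u else f u.
Proof. exact: ffunE. Qed.

Lemma del_matching n (x : point n) (f : pairing n) :
  matching f -> matching (del x f).
Proof.
move=> [fK ncf]; split=> [u|a b]; rewrite !delE.
  case ux: ((u == x) || (u == f x)); first by rewrite ux.
  by rewrite (inv_eq fK) (can_eq fK) orbC ux fK.
case: ifP => [|ax ba bfa]; first by rewrite !sepxx.
case: ifP => // bx; exact: ncf.
Qed.

(** On the way from p to q the arc at x is met before the arc at x': the point x' lies beyond the
    first arc, together with q, and x lies before the second, together with p. *)
Definition nested n (f : pairing n) (p q x x' : point n) : bool :=
  (sep x (f x) x' == sep x (f x) q) && (sep x' (f x') x == sep x' (f x') p).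

(* The overstrand is generalised to a chord from p to q: once it has been cut at
   its first crossing, the rest of it is a chord from z to q. *)
Lemma resolve_fromP n (xs : seq (point n * bool)) (f : pairing n) p q :
  matching f -> f p = p -> f q = q -> p != q ->
  (forall u, (u \in unzip1 xs) || (f u \in unzip1 xs)
             = (sep u (f u) p != sep u (f u) q)) ->
  pairwise (nested f p q) (unzip1 xs) ->
  let g := resolve_from f p q xs in
  [/\ matching g, forall u, (g u == u) = [&& f u == u, u != p & u != q] &
      forall u, u != p -> u != q -> u \notin unzip1 xs -> f u \notin unzip1 xs ->
        g u = f u].
Proof.
elim: xs f p => [|[x isA] xs IH] f p mf fp fq pq crossP nestP g; rewrite {}/g.
  have [fK ncf] := mf; split=> [|u|u up uq _ _] /=; last by rewrite joinE (negPf up) (negPf uq).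
    apply: join_matching => // b bp bq.
    have [->//|bfb] := eqVneq (f b) b.
    have fbp : f b != p by rewrite (inv_eq fK) fp.
    have fbq : f b != q by rewrite (inv_eq fK) fq.
    apply: sep_swap; rewrite 1?[_ == b]eq_sym 1?[_ == f b]eq_sym //.
    by apply/eqP; rewrite -[_ == _]negbK -crossP.
  rewrite joinE; case: (eqVneq u p) => [->|up]; first by rewrite fp eqxx eq_sym (negPf pq).
  by case: (eqVneq u q) => [->|uq]; rewrite ?(negPf pq) ?andbF ?andbT.
have [fK ncf] := mf.
rewrite /= in crossP nestP *.
set X := unzip1 xs in crossP nestP *.
have xN (u : point n) : f u = u -> u \notin x :: X.
  move=> fu; apply: contraFN (sepxx u p) => ux.
  by have := crossP u; rewrite fu !sepxx ux.
have fxx : f x != x by apply: contraTneq (mem_head x X) => /xN.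
have crossx : sep x (f x) p != sep x (f x) q by rewrite -crossP mem_head.
have {nestP} /andP[/allP nestx nestP] := nestP.
have xX : x \notin X.
  by apply: contra crossx => /nestx; rewrite /nested sepl => /andP[/eqP<- /eqP<-].
have fxX : f x \notin X.
  apply: contra crossx => /nestx; rewrite /nested fK sepr sepr (sepC (f x)).
  by move=> /andP[/eqP<- /eqP<-].
(* The piece of the overstrand before the crossing ends at y; the rest is a chord from z to q, to
   which the induction hypothesis applies in [f1]. *)
set y := if isA then f x else x; set z := if isA then x else f x.
have [fy fz] : f y = z /\ f z = y by rewrite /y /z; case: (isA).
have inyz u : (u == x) || (u == f x) = (u == y) || (u == z).
  by rewrite /y /z; case: (isA); rewrite // orbC.
have yX : y \notin X by rewrite /y; case: (isA).
have zX : z \notin X by rewrite /z; case: (isA).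
have yz : y != z by rewrite /y /z; case: (isA); rewrite // eq_sym.
have sepyz u : sep x (f x) u = sep y z u by rewrite /y /z; case: (isA); rewrite // sepC.
rewrite !sepyz in crossx.
have fix_yz w : f w = w -> (w != y) && (w != z).
  move=> fw; apply/andP; split; apply: contraNneq yz => wy.
    by rewrite -fy -wy fw.
  by rewrite -fz -wy fw.
have /andP[py pz] := fix_yz _ fp; have /andP[qy qz] := fix_yz _ fq.
set f1 := del x f.
have f1E u : f1 u = if (u == y) || (u == z) then u else f u by rewrite delE inyz.
have mf1 : matching f1 by apply: del_matching.
(* An arc that is not met has p and q on one side, and z as well, because the arc yz crosses the
   chord pq. *)
have off u : u \notin x :: X -> f u \notin x :: X ->
    sep u (f u) p = sep u (f u) q /\ sep u (f u) p = sep u (f u) z.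
  rewrite !inE !negb_or => /andP[ux uX] /andP[fux fuX].
  have := crossP u; rewrite !inE (negPf ux) (negPf uX) (negPf fux) (negPf fuX) /=.
  move=> /esym/negbFE/eqP pqu.
  have [fu|ufu] := eqVneq u (f u); first by rewrite -fu !sepxx.
  have /norP[uy uz] : ~~ ((u == y) || (u == z)) by rewrite -inyz -(inv_eq fK) negb_or ux.
  have fuy : f u != y by rewrite (inv_eq fK) fy.
  have fuz : f u != z by rewrite (inv_eq fK) fz.
  have yzu : sep u (f u) y = sep u (f u) z by rewrite ncf ?fy // eq_sym.
  split=> //; rewrite -yzu; by apply: (sep_cross _ _ _ _ _ _ crossx) => //; rewrite eq_sym.
(* Arcs met later have z on the same side as p, so the chord from z to q meets them too. *)
have onz w : (w \in X) || (f w \in X) -> sep w (f w) z = sep w (f w) p.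
  have X1 v : v \in X -> sep v (f v) z = sep v (f v) p.
    move=> vX; have /andP[_ /eqP <-] := nestx _ vX.
    have xv : x != v by apply: contraNneq xX => ->.
    have xfv : x != f v by rewrite eq_sym (inv_eq fK); apply: contraNneq fxX => <-.
    by rewrite /z; case: (isA) => //; rewrite [RHS]ncf.
  by move=> /orP[/X1 //|/X1]; rewrite fK !(sepC (f w)).
have f1X : {in X, f =1 f1}.
  move=> w wX; rewrite f1E ifF //; apply/negbTE; rewrite negb_or.
  by apply/andP; split; [apply: contraNneq yX | apply: contraNneq zX] => <-.
have [|||||mR fixR offR] := IH f1 z mf1; rewrite ?f1E ?eqxx ?orbT //.
- by rewrite (negPf qy) (negPf qz).
- by rewrite eq_sym.
- move=> u; rewrite f1E; case: ifP => [/pred2P[->|->]|/norP[uy uz]].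
  + by rewrite (negPf yX) !sepxx.
  + by rewrite (negPf zX) !sepxx.
  have ux : u != x by have /norP[] : ~~ ((u == x) || (u == f x)) by rewrite inyz negb_or uy.
  have fux : f u != x by rewrite (inv_eq fK); have /norP[] : ~~ ((u == x) || (u == f x)) by rewrite inyz negb_or uy.
  rewrite -/X; case uX: (_ || _).
    have -> : sep u (f u) z = sep u (f u) p by apply: onz; rewrite -/X.
    by rewrite -crossP !inE (negPf ux) (negPf fux) uX.
  have /norP[uX' fuX] := negbT uX.
  have [||-> ->] := off u; rewrite ?inE ?negb_or ?ux ?fux ?eqxx //.
- apply: (@sub_in_pairwise _ (mem X)) nestP; last exact/allP.
  move=> v w vX wX; rewrite /nested -(f1X v) // -(f1X w) //.
  by have -> : sep w (f w) z = sep w (f w) p by apply: onz; apply/orP; left.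
set R := resolve_from f1 z q xs in mR fixR offR *.
have gE : join p y (resolve_from f z q xs) = join p y R.
  apply/ffunP => u; rewrite !joinE; do 2!case: eqP => // ?.
  apply: resolve_from_eq => //; rewrite f1E; case: ifP => //; last by rewrite eqxx !orbT.
  by case/orP => [/eqP //|->].
rewrite {}gE; have [RK ncR] := mR.
have Rp : R p = p by apply/eqP; rewrite fixR f1E (negPf py) (negPf pz) fp eqxx pq.
have Ry : R y = y by apply/eqP; rewrite fixR f1E !eqxx yz eq_sym.
(* These include all points whose partner in [R] differs from that in [f1]. They lie on the same
   side of the chord py as q, so the new arc py crosses no arc between them. *)
pose far w := [|| w == z, w == q, w \in X | f w \in X].
have pz_pq : sep p y z = sep p y q.
  by apply: sep_beyond crossx => //; rewrite eq_sym.
have far_sep w : far w -> sep p y w = sep p y q.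
  have seq_w : (w \in X) || (f w \in X) -> sep y z w = sep y z q.
    have X1 v : v \in X -> sep y z v = sep y z q.
      by move=> /nestx /andP[/eqP]; rewrite !sepyz.
    move=> /orP[/X1 //|fwX]; rewrite -(X1 _ fwX) -!sepyz; apply: ncf.
      by apply: contraNneq fxX => <-.
    by apply: contraNneq xX => wfx; rewrite wfx fK in fwX.
  case/or3P => [/eqP-> //|/eqP-> //|wX].
  have {}seq_w := seq_w wX.
  have /andP[wy wz] : (w != y) && (w != z).
    apply/andP; split; apply: contraTneq wX => ->; rewrite ?fy ?fz negb_or;
    by rewrite ?yX ?zX.
  rewrite -pz_pq; apply/esym; apply: sep_beyond; rewrite ?seq_w // eq_sym //.
split=> [|u|u up uq].
- apply: join_matching => // b bp b_y.
  have [farb|nfarb] := boolP (far b).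
    rewrite far_sep // far_sep //; apply: contraT => nfarR.
    have /norP[Rz /norP[Rq /norP[RX fRX]]] := nfarR.
    have Ry' : R b != y by rewrite (inv_eq RK) Ry.
    have := offR _ Rz Rq RX; rewrite f1E (negPf Ry') (negPf Rz) => /(_ fRX).
    rewrite RK => bE; move: farb; rewrite /far bE fK (negPf RX) (negPf fRX) orbF.
    by rewrite !(inv_eq fK) fz fq (negPf Ry') (negPf Rq).
  have /norP[bz /norP[bq /norP[bX fbX]]] := nfarb.
  rewrite offR // f1E ?(negPf b_y) ?(negPf bz) //=.
  have [<-//|bfb] := eqVneq b (f b).
  have fbp : f b != p by rewrite (inv_eq fK) fp.
  have fby : f b != y by rewrite (inv_eq fK) fy.
  have /norP[bx bfx] : ~~ ((b == x) || (b == f x)) by rewrite inyz negb_or b_y.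
  have pb : p != b by rewrite eq_sym.
  have yb : y != b by rewrite eq_sym.
  have pfb : p != f b by rewrite eq_sym.
  have yfb : y != f b by rewrite eq_sym.
  apply: (sep_swap py pb pfb yb yfb).
  have [||_ ->] := off b; rewrite ?inE ?negb_or ?bx ?(inv_eq fK) ?bfx //.
  by rewrite -fy; apply/esym; apply: ncf; rewrite // fy.
- rewrite joinE; case: (eqVneq u p) => [->|up]; first by rewrite eq_sym (negPf py) andbF.
  case: (eqVneq u y) => [->|uy].
    by rewrite (negPf py) fy eq_sym (negPf yz).
  rewrite fixR f1E (negPf uy) /=; case: (eqVneq u z) => [->|uz] //=.
  by rewrite fz (negPf yz) andbF.
- rewrite !inE !negb_or => /andP[ux uX] /andP[fux fuX].
  have /norP[uy uz] : ~~ ((u == y) || (u == z)) by rewrite -inyz -(inv_eq fK) negb_or ux.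
  by rewrite joinE (negPf up) (negPf uy) offR ?f1E ?(negPf uy) ?(negPf uz).
Qed.

(** * Resolving an overstrand *)

Definition right n (o : 'I_n) (u : point n) : bool := strand_src o < u < strand_tgt o.

Lemma src_lt_tgt n (o : 'I_n) : strand_src o < strand_tgt o.
Proof. by rewrite /strand_src /strand_tgt /=; have := ltn_ord o; lia. Qed.

Lemma right_src n (o : 'I_n) : right o (strand_src o) = false.
Proof. by rewrite /right ltnn. Qed.

Lemma right_tgt n (o : 'I_n) : right o (strand_tgt o) = false.
Proof. by rewrite /right ltnn andbF. Qed.

Lemma mem_crossed n (o : 'I_n) (f : pairing n) u :
  (u \in crossed o f) = right o u && ~~ right o (f u).
Proof. by rewrite mem_filter mem_enum inE andbT. Qed.

Local Notation ltp := (fun u v => nat_of_ord u < nat_of_ord v).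

Lemma crossed_pairwise n (o : 'I_n) (f : pairing n) : pairwise ltp (crossed o f).
Proof.
apply: pairwise_filter; rewrite -sorted_pairwise; last exact: ltn_trans.
have := iota_ltn_sorted 0 (n + n); rewrite -val_enum_ord.
by rewrite sorted_map.
Qed.

Lemma crossed_eq n (o : 'I_n) (f : pairing n) (L : seq (point n)) : sorted ltp L ->
  (forall u, (u \in L) = right o u && ~~ right o (f u)) -> crossed o f = L.
Proof.
move=> sL mL; apply: (@irr_sorted_eq _ ltp) => //.
- by move=> ? ? ?; apply: ltn_trans.
- by move=> ?; rewrite /= ltnn.
- by rewrite sorted_pairwise ?crossed_pairwise // => ? ? ?; apply: ltn_trans.
- by move=> u; rewrite mem_crossed mL.
Qed.

(** Here a and b are the ends of the overstrand, x and x' lie on its right, and y and y' on its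
    left. *)
Lemma nested_nat (a b x x' y y' : nat) : a < x -> x < x' -> x' < b ->
  (y < a) || (b < y) -> (y' < a) || (b < y') ->
  (sep x y x' == sep x y b) && (sep x' y' x == sep x' y' a).
Proof.
move=> ax xx' x'b /orP[ya|ya] /orP[y'a|y'a].
- by rewrite !(sepC _ y) !(sepC _ y') !sepE; lia.
- by rewrite !(sepC _ y) !sepE; lia.
- by rewrite !(sepC _ y') !sepE; lia.
- by rewrite !sepE; lia.
Qed.

Section Overstrand.
Variables (n : nat) (o : 'I_n) (f : pairing n).
Hypotheses (mf : matching f) (fs : f (strand_src o) = strand_src o)
  (ft : f (strand_tgt o) = strand_tgt o).
Let s := strand_src o.
Let t := strand_tgt o.
Let X := crossed o f.

Lemma src_neq_tgt : s != t.
Proof. by apply: contraTneq (src_lt_tgt o); rewrite -/s -/t => ->; rewrite ltnn. Qed.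

(** Symmetry of crossing turns the description of [crossed] by the sides of the overstrand into the
    form that [resolve_fromP] takes. *)
Lemma crossed_crossing (u : point n) :
  (u \in X) || (f u \in X) = (sep u (f u) s != sep u (f u) t).
Proof.
have fK := mf.1; rewrite !mem_crossed fK.
have -> : right o u && ~~ right o (f u) || right o (f u) && ~~ right o u
          = (right o u != right o (f u)) by case: (right o u); case: (right o (f u)).
have [<-|ufu] := eqVneq u (f u); first by rewrite !sepxx eqxx.
have [us ut] : u != s /\ u != t.
  by split; apply: contraNneq ufu => ->; rewrite ?fs ?ft.
have [fus fut] : f u != s /\ f u != t by rewrite !(inv_eq fK) fs ft.
have [su tu] : s != u /\ t != u by rewrite ![_ == u]eq_sym.
have [sfu tfu] : s != f u /\ t != f u by rewrite ![_ == f u]eq_sym.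
by rewrite /right -!(sepE _ (src_lt_tgt o)) (sep_sym src_neq_tgt ufu su sfu tu tfu).
Qed.

Lemma out_of_right (x : point n) : x \in X -> (f x < s) || (t < f x).
Proof.
have fK := mf.1; rewrite mem_crossed => /andP[rx nrx].
have fxs : f x != s by rewrite (inv_eq fK) fs; apply: contraTneq rx => ->; rewrite right_src.
have fxt : f x != t by rewrite (inv_eq fK) ft; apply: contraTneq rx => ->; rewrite right_tgt.
move: nrx fxs fxt; rewrite /right -!val_eqE /= -/s -/t; lia.
Qed.

Lemma crossed_nested : pairwise (nested f s t) X.
Proof.
apply: (@sub_in_pairwise _ (mem X)) (crossed_pairwise o f); last exact/allP.
move=> x x' xX x'X xx'.
have /andP[/andP[sx _] _] : right o x && ~~ right o (f x) by rewrite -mem_crossed.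
have /andP[/andP[_ x't] _] : right o x' && ~~ right o (f x') by rewrite -mem_crossed.
by apply: nested_nat; rewrite ?out_of_right.
Qed.

Lemma resolveP e : size e = size X ->
  let g := resolve o f e in
  [/\ matching g, forall u, (g u == u) = [&& f u == u, u != s & u != t] &
      forall u, u != s -> u != t -> u \notin X -> f u \notin X -> g u = f u].
Proof.
move=> se; have Xe : unzip1 (zip X e) = X by rewrite unzip1_zip ?se.
have := @resolve_fromP n (zip X e) f s t mf fs ft src_neq_tgt.
by rewrite Xe; apply; [apply: crossed_crossing | apply: crossed_nested].
Qed.

Lemma crossed_uniq : uniq (s :: t :: X ++ [seq f x | x <- X]).
Proof.
have fK := mf.1.
have sX : s \notin X by rewrite mem_crossed right_src.
have tX : t \notin X by rewrite mem_crossed right_tgt.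
have memf u : (u \in [seq f x | x <- X]) = (f u \in X).
  by rewrite -{1}(fK u) mem_map //; apply: inv_inj.
rewrite /= !inE !mem_cat !memf fs ft (negPf src_neq_tgt) (negPf sX) (negPf tX) /=.
rewrite cat_uniq (map_inj_uniq (inv_inj fK)).
have -> : uniq X by rewrite filter_uniq ?enum_uniq.
rewrite andbT /=.
apply/hasPn => u; rewrite memf !mem_crossed fK => /andP[-> /negPf->] //.
Qed.

End Overstrand.

(** * Split moves and single changes of choice *)

Definition diff n (f g : pairing n) : nat := #|[pred u | f u != g u]|.
(* For splits: related by one split move, which changes the partners of exactly four points. *)
Definition near n (f g : pairing n) : bool := (f != g) && (diff f g <= 4).

Lemma diff_le n (f g : pairing n) (L : seq (point n)) :
  (forall u, u \notin L -> f u = g u) -> diff f g <= size L.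
Proof.
move=> H; apply: leq_trans (card_size L); apply: subset_leq_card.
by apply/subsetP => u; rewrite inE; apply: contraNT => /H->.
Qed.

Lemma diffC n (f g : pairing n) : diff f g = diff g f.
Proof. by apply: eq_card => u; rewrite !inE eq_sym. Qed.

Lemma diff_join n (f g : pairing n) a b : diff (join a b f) (join a b g) <= diff f g.
Proof.
apply: subset_leq_card; apply/subsetP => u; rewrite !inE !joinE.
by do 2?case: ifP; rewrite ?eqxx.
Qed.

Definition sgn (b : bool) : int := (if b then 1 else -1)%R.

Lemma weight_cons b e : weight (b :: e) = (sgn b + weight e)%R.
Proof. by rewrite /weight big_cons. Qed.

Lemma weight_cat e1 e2 : weight (e1 ++ e2) = (weight e1 + weight e2)%R.
Proof. by rewrite /weight big_cat. Qed.

Lemma weight_nil : weight [::] = 0%R.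
Proof. by rewrite /weight big_nil. Qed.

(** The other choice at x exchanges the roles of x and [f x], so only these two, the start of the
    piece before x and the end of the piece after x change partners. *)
Lemma resolve_from_flip n (f : pairing n) xs1 x b xs2 p q :
  let xs := xs1 ++ (x, b) :: xs2 in
  uniq (p :: q :: unzip1 xs ++ [seq f x | x <- unzip1 xs]) ->
  near (resolve_from f p q xs) (resolve_from f p q (xs1 ++ (x, ~~ b) :: xs2)).
Proof.
move=> xs U.
(* The point u is located so that the outer [join] of the induction does not overwrite it. *)
have [[u _ nu] D] : (exists2 u, u \in p :: unzip1 xs ++ [seq f x | x <- unzip1 xs] &
   resolve_from f p q xs u != resolve_from f p q (xs1 ++ (x, ~~ b) :: xs2) u)
   /\ diff (resolve_from f p q xs) (resolve_from f p q (xs1 ++ (x, ~~ b) :: xs2)) <= 4.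
  rewrite {}/xs in U *; elim: xs1 p U => [|[x1 b1] xs1 IH] p /= U.
    have fx : f x != x.
      case/and4P: U => _ _; rewrite mem_cat inE => /norP[_ /norP[]]; rewrite eq_sym //.
    split.
      exists p; rewrite ?mem_head // !joinE eqxx.
      by case: (b); rewrite //= eq_sym.
    (* The piece of the overstrand after x ends at r: at q, or at the next arc met. *)
    set r := match xs2 with [::] => q | (x', b') :: _ => if b' then f x' else x' end.
    apply: (@diff_le _ _ _ [:: p; x; f x; r]) => v; rewrite !inE !negb_or => /and4P[vp vx vfx vr].
    rewrite !joinE (negPf vp); case: (b) => /=; rewrite (negPf vx) (negPf vfx);
    by rewrite {}/r in vr; case: xs2 vr {U} => [|[x' b'] xs2] vr; rewrite /= !joinE (negPf vr) ?(negPf vx) ?(negPf vfx).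
  set z := if b1 then x1 else f x1; set y := if b1 then f x1 else x1.
  set X := unzip1 _ in U IH *.
  have Uz : uniq (z :: q :: X ++ [seq f x | x <- X]) /\ forall u, u \in z :: X ++ [seq f x | x <- X] -> (u != p) && (u != y).
    set W := X ++ _.
    have /perm_uniq : perm_eq (p :: q :: x1 :: X ++ f x1 :: [seq f x | x <- X])
                              (p :: y :: z :: q :: W).
      apply/seq.permP => a; rewrite /= !count_cat /= /y /z; case: (b1) => /=; lia.
    rewrite /= U => /esym/and3P[/norP[_ /norP[zp]]].
    rewrite !inE !negb_or => /andP[_ pW] /and3P[zy _ yW] ->; split=> // u.
    rewrite inE => /predU1P[->|uW]; first by rewrite ![z == _]eq_sym zp zy.
    by apply/andP; split; apply: contraTneq uW => ->.
  have [[u uX nu] D] := IH z Uz.1.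
  split; last exact: leq_trans (diff_join _ _ _ _) D.
  exists u.
    move: uX; rewrite /z !inE !mem_cat inE; case: (b1) => /orP[->|/orP[]->]; rewrite ?orbT //.
  by have /andP[up uy] := Uz.2 _ uX; rewrite !joinE (negPf up) (negPf uy).
by rewrite /near D andbT; apply: contraNneq nu => ->.
Qed.

Lemma resolve_flip n (o : 'I_n) (f : pairing n) b e : matching f ->
  f (strand_src o) = strand_src o -> f (strand_tgt o) = strand_tgt o ->
  size e = size (crossed o f) -> ~~ b \in e ->
  exists e', [/\ size e' = size e, weight e' = (weight e + sgn b *+ 2)%R &
    near (resolve o f e) (resolve o f e')].
Proof.
move=> mf fs ft se be; have [e1 [e2 eE]] : exists e1 e2, e = e1 ++ ~~ b :: e2.
  by have [e1 e2] := splitPr be; exists e1, e2.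
exists (e1 ++ b :: e2); split.
- by rewrite eE !size_cat.
- rewrite eE !weight_cat !weight_cons /sgn; case: (b) => /=; lia.
have s1 : size e1 <= size (crossed o f) by rewrite -se eE size_cat leq_addr.
have s2 : size e1 < size (crossed o f) by rewrite -se eE size_cat /=; lia.
have XE : crossed o f = take (size e1) (crossed o f) ++
   nth (strand_src o) (crossed o f) (size e1) :: drop (size e1).+1 (crossed o f).
  by rewrite -drop_nth ?cat_take_drop.
have st : size (take (size e1) (crossed o f)) = size e1 by rewrite size_takel.
rewrite /resolve {}eE in se *; rewrite XE !zip_cat //=.
set x := nth _ _ _; set xs1 := zip _ e1; set xs2 := zip _ e2.
have := @resolve_from_flip _ f xs1 x (~~ b) xs2 (strand_src o) (strand_tgt o).
have xsE : unzip1 (xs1 ++ (x, ~~ b) :: xs2) = crossed o f.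
  rewrite XE /unzip1 map_cat /= -!/(unzip1 _) !unzip1_zip ?st //.
  by rewrite size_drop -se size_cat /=; lia.
by rewrite negbK; apply; rewrite xsE crossed_uniq.
Qed.

(** The points where [f] and [g] differ form a set closed under both involutions. It contains the
    four listed points, hence consists of them, and the only possible value of [g (f a)] among them
    is [f (g a)]. *)
Lemma near_swap n (f g : pairing n) a : involutive f -> involutive g ->
  (forall u, (f u == u) = (g u == u)) -> near f g -> f a != g a ->
  [/\ g (f a) = f (g a), uniq [:: a; f a; g a; f (g a)] &
      forall u, u \notin [:: a; f a; g a; f (g a)] -> f u = g u].
Proof.
move=> fK gK fix_fg /andP[_ D4] fga.
have gaa : g a != a.
  by apply: contraNneq fga => ga; rewrite ga -[_ == _]/(f a == a) fix_fg ga.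
have faa : f a != a by rewrite fix_fg.
have fD u : f u != g u -> f (f u) != g (f u).
  by rewrite fK; apply: contraNneq => H; rewrite [X in g X]H gK.
have gD u : f u != g u -> f (g u) != g (g u).
  by rewrite gK; apply: contraNneq => H; rewrite -[X in f X]H fK.
have ffga : f (g a) != g a by rewrite fix_fg gK eq_sym.
have fgaa : f (g a) != a by rewrite (inv_eq fK) eq_sym.
have U : uniq [:: a; f a; g a; f (g a)].
  rewrite /= !inE !negb_or /= (can_eq fK) fga ![a == _]eq_sym faa gaa fgaa.
  by rewrite [g a == _]eq_sym ffga.
have sub : {subset [:: a; f a; g a; f (g a)] <= [pred u | f u != g u]}.
  move=> u; rewrite !inE => /or4P[] /eqP-> //; [apply: fD|apply: gD|apply/fD/gD] => //.
have inD u : (u \in [:: a; f a; g a; f (g a)]) = (f u != g u).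
  apply/idP/idP => [/sub //|uD]; apply: contraLR D4 => uL; rewrite -ltnNge.
  have UL : uniq (u :: [:: a; f a; g a; f (g a)]) by rewrite cons_uniq uL.
  rewrite -[4.+1]/(size (u :: [:: a; f a; g a; f (g a)])) -(card_uniqP UL).
  apply: subset_leq_card; apply/subsetP => v; rewrite in_cons => /predU1P[->|/sub] //.
split=> //; last by move=> u; rewrite inD negbK => /eqP.
have : g (f a) \in [:: a; f a; g a; f (g a)] by rewrite inD; apply/gD/fD.
rewrite !inE => /or4P[] /eqP // H.
- by case/eqP: fga; rewrite -[in RHS]H gK.
- by move: (fix_fg (f a)); rewrite fK H eqxx eq_sym (negPf faa).
- by move: faa; rewrite -(can_eq gK) H eqxx.
Qed.

Lemma sgn_neg b : sgn (~~ b) = (- sgn b)%R.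
Proof. by case: b. Qed.

(** * Lifting a split move through the overstrand *)

Section Lift.
Variables (n : nat) (o : 'I_n) (f g : pairing n) (b : bool).
Hypotheses (mf : matching f) (fs : f (strand_src o) = strand_src o)
  (ft : f (strand_tgt o) = strand_tgt o).
Hypotheses (mg : matching g) (fix_fg : forall u, (f u == u) = (g u == u)).
Hypothesis fg : near f g.
Let s := strand_src o.
Let t := strand_tgt o.
Let X := crossed o f.
Let S := resolve o f (nseq (size X) b).
Let lifted := exists e, [/\ size e = size (crossed o g),
   weight e = weight (nseq (size X) b) & near S (resolve o g e)].

Lemma nearI (h k : pairing n) (L : seq (point n)) u : h u != k u -> size L <= 4 ->
  (forall v, v \notin L -> h v = k v) -> near h k.
Proof.
move=> hk sL H; apply/andP; split; first by apply: contraNneq hk => ->.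
exact: leq_trans (diff_le H) sL.
Qed.

(** All four ends of the move lie on one side of the overstrand, which meets the same arcs before
    and after it; the same choices are kept. *)
Lemma lift_same_crossed a : f a != g a ->
  (forall u, f u != g u -> right o u = right o (f u)) ->
  (forall u, f u != g u -> right o u = right o (g u)) -> lifted.
Proof.
move=> fga Rf Rg.
have [_ _ fgE] := near_swap mf.1 mg.1 fix_fg fg fga.
have XX : crossed o g = X.
  apply: crossed_eq; first by rewrite sorted_pairwise ?crossed_pairwise // => ? ? ?; apply: ltn_trans.
  move=> u; rewrite mem_crossed.
  by have [->//|D] := eqVneq (f u) (g u); rewrite -Rf // -Rg.
exists (nseq (size X) b); rewrite XX size_nseq; split=> //.
have gs : g s = s by apply/eqP; rewrite -fix_fg fs.
have gt : g t = t by apply/eqP; rewrite -fix_fg ft.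
have [_ _ off] := resolveP mf fs ft (size_nseq (size X) b).
have [_ _ offg] := @resolveP n o g mg gs gt (nseq (size X) b) (etrans (size_nseq _ _) (congr1 _ (esym XX))).
have as_ : a != s by apply: contraNneq fga => ->; rewrite fs gs.
have at_ : a != t by apply: contraNneq fga => ->; rewrite ft gt.
have aX : a \notin X by rewrite mem_crossed -Rf // andbN.
have faX : f a \notin X by rewrite mem_crossed mf.1 -Rf // andbN.
have gaX : g a \notin X by rewrite -XX mem_crossed mg.1 -Rg // andbN.
apply: (@nearI _ _ [:: a; f a; g a; f (g a)] a) => //.
  by rewrite off // offg ?XX.
move=> u /fgE fgu; rewrite /S /resolve XX; apply: resolve_from_eq; last by rewrite fgu eqxx !orbT.
rewrite unzip1_zip ?size_nseq // => v vX; apply/eqP.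
by apply: contraTT vX => D; rewrite mem_crossed -Rf // andbN.
Qed.

Lemma resolve1 (h : pairing n) (x y z : point n) : crossed o h = [:: x] ->
  y = (if b then h x else x) -> z = (if b then x else h x) ->
  resolve o h [:: b] = join s y (join z t h).
Proof. by rewrite /resolve => -> -> ->; case: (b). Qed.

(** The move acts on the only arc met, yz, and on an arc cd lying on one side. Afterwards exactly
    one of yc and zd is met; the choice [b] there keeps the arc sy or the arc zt, and a split move
    on the other arcs remains. *)
Lemma lift_crossing_arc x : X = [:: x] -> f x != g x -> lifted.
Proof.
move=> XE fgx.
have fK := mf.1; have gK := mg.1.
have /andP[rx rfx] : right o x && ~~ right o (f x) by rewrite -mem_crossed -/X XE mem_head.
pose y := if b then f x else x; pose z := if b then x else f x.
have fy : f y = z by rewrite /y /z; case: (b).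
have ry : right o y = ~~ b by rewrite /y; case: (b); rewrite ?(negPf rfx).
have rz : right o z = b by rewrite /z; case: (b); rewrite ?(negPf rfx).
have fgy : f y != g y.
  rewrite /y; case: (b) => //; rewrite fK; apply: contraNneq fgx => H.
  by rewrite [X in g X]H gK.
have [] := near_swap fK gK fix_fg fg fgy; rewrite fy.
set c := g y; set d := f c => gz U fgE.
have fE u : (u \in X) = (u == x) by rewrite XE inE.
have rcd : right o c = right o d.
  have cN : (c != x) && (d != x).
    move: U; rewrite /= !inE !negb_or /y /z; case: (b) => /=;
    by rewrite [c == x]eq_sym [d == x]eq_sym => /and4P[/and3P[? ? ?] /andP[? ?] _ _]; apply/andP.
  have /andP[cx dx] := cN.
  have := fE c; have := fE d; rewrite !mem_crossed fK -/d (negPf cx) (negPf dx).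
  by case: (right o c); case: (right o d).
have SE : S = join s y (join z t f) by rewrite /S XE; exact: (resolve1 XE erefl erefl).
have gc : g c = y by rewrite /c gK.
have gd : g d = z by rewrite -gz gK.
have [/and4P[]] := (U, isT); rewrite !inE !negb_or => /and3P[yz yc yd] /andP[zc zd] cd _.
have gR u : u \notin [:: y; z; c; d] -> right o u && ~~ right o (g u) = false.
  move=> uL; rewrite -fgE // -mem_crossed -/X fE; apply: contraNF uL => /eqP->.
  by rewrite !inE /y /z; case: (b); rewrite eqxx ?orbT.
have gX x' : x' \in [:: y; z; c; d] ->
    {in [:: y; z; c; d], forall u, right o u && ~~ right o (g u) = (u == x')} ->
    crossed o g = [:: x'].
  move=> x'L H; apply: crossed_eq => // u; rewrite inE.
  have [/H->//|uL] := boolP (u \in [:: y; z; c; d]).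
  by rewrite gR //; apply: contraNF uL => /eqP->.
have yt : y != t by apply: contraNneq yz => y_t; rewrite -fy y_t ft.
have ys : y != s by apply: contraNneq yz => y_s; rewrite -fy y_s fs.
have zt : z != t by rewrite -fy (inv_eq fK) ft.
have zs : z != s by rewrite -fy (inv_eq fK) fs.
have gs : g s = s by apply/eqP; rewrite -fix_fg fs.
have gt : g t = t by apply/eqP; rewrite -fix_fg ft.
have ct : c != t by rewrite /c (inv_eq gK) gt.
have cs : c != s by rewrite /c (inv_eq gK) gs.
have dt : d != t by rewrite -(can_eq gK) gd gt.
have ds : d != s by rewrite -(can_eq gK) gd gs.
have tsF : (t == s) = false by rewrite eq_sym (negPf (src_neq_tgt o)).
have tyF : (t == y) = false by rewrite eq_sym (negPf yt).
have tzF : (t == z) = false by rewrite eq_sym (negPf zt).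
have tcF : (t == c) = false by rewrite eq_sym (negPf ct).
have [[[[yzF ycF] [ydF zcF]] zdF] cdF] := (negPf yz, negPf yc, (negPf yd, negPf zc), negPf zd, negPf cd).
have [[[zyF cyF] [dyF czF]] [dcF dzF]] := (etrans (eq_sym z y) yzF, etrans (eq_sym c y) ycF,
  (etrans (eq_sym d y) ydF, etrans (eq_sym c z) zcF), (etrans (eq_sym d c) cdF, etrans (eq_sym d z) zdF)).
(* Here c and d lie on the side of z, so yc is the arc met. *)
have [rc|] := eqVneq (right o c) b.
  pose x' := if b then c else y.
  have X' : crossed o g = [:: x'].
    apply: gX => [|u]; first by rewrite /x' !inE; case: (b); rewrite eqxx ?orbT.
    by rewrite !inE /x' => /or4P[] /eqP->; rewrite ?gc ?gd ?gz -/c -?rcd ?rc ?ry ?rz;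
      case: (b); rewrite ?eqxx ?yzF ?ycF ?zcF ?dyF ?zyF ?dcF ?cyF.
  exists [:: b]; rewrite X' XE; split=> //.
  have -> : resolve o g [:: b] = join s y (join c t g).
    by apply: (resolve1 X'); rewrite /x'; case: (b); rewrite ?gc.
  rewrite SE.
  apply: (@nearI _ _ [:: z; t; c; d] t) => //.
    by rewrite !joinE tsF tyF tzF tcF eqxx.
  move=> v; rewrite !inE !negb_or => /and4P[vz vt vc vd]; rewrite !joinE.
  rewrite (negPf vz) (negPf vt) (negPf vc); do 2!case: eqP => // ?.
  by apply: fgE; rewrite !inE !negb_or vz vc vd !andbT; apply/eqP.
move=> rcN; have {rcN} rc : right o c = ~~ b by case: (right o c) rcN; case: (b).
(* Here c and d lie on the side of y, so zd is the arc met. *)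
pose x' := if b then z else d.
have X' : crossed o g = [:: x'].
  apply: gX => [|u]; first by rewrite /x' !inE; case: (b); rewrite eqxx ?orbT.
  by rewrite !inE /x' => /or4P[] /eqP->; rewrite ?gc ?gd ?gz -/c -?rcd ?rc ?ry ?rz;
    case: (b); rewrite ?eqxx ?yzF ?czF ?zdF ?ydF ?cdF ?dzF.
exists [:: b]; rewrite X' XE; split=> //.
have -> : resolve o g [:: b] = join s d (join z t g).
  by apply: (resolve1 X'); rewrite /x'; case: (b); rewrite ?gd ?gz.
rewrite SE; apply: (@nearI _ _ [:: s; y; c; d] s) => //.
  by rewrite !joinE eqxx.
move=> v; rewrite !inE !negb_or => /and4P[vs vy vc vd]; rewrite !joinE.
rewrite (negPf vs) (negPf vy) (negPf vd); do 2!case: eqP => // ?.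
by apply: fgE; rewrite !inE !negb_or vy vc vd !andbT; apply/eqP.
Qed.

(** Otherwise the arc at x1 would enclose the whole arc at x on the right of the overstrand. *)
Lemma noncrossing_right x x1 : right o x1 -> right o (f x1) ->
  right o x -> ~~ right o (f x) -> (x1 < x < f x1) = false.
Proof.
move=> r1 r2 rx rfx; apply/negbTE/negP => /andP[x1x xx2].
have x12 := ltn_trans x1x xx2.
have := mf.2 x1 x; rewrite !sepE // x1x xx2 /= => H.
have /andP[H1 H2] : x1 < f x < f x1.
  apply/esym/H; first by rewrite -val_eqE neq_ltn x1x orbT.
  by rewrite -val_eqE neq_ltn xx2.
case/negP: rfx; case/andP: r1 => r1 _; case/andP: r2 => _ r2.
by rewrite /right (ltn_trans r1 H1) (ltn_trans H2 r2).
Qed.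

(* The two new double crossings are resolved in opposite ways, so that the
   weight does not change. *)
Lemma lift_new_crossings a : size X <= 1 -> f a != g a -> right o a != right o (g a) ->
  (forall u, f u != g u -> right o u = right o (f u)) -> lifted.
Proof.
have fK := mf.1; have gK := mg.1.
move=> X1 fga Rga Rf.
(* Of the two arcs of [f] that the move changes, one lies on the right and one on the left; x1 is
   the lower end of the one on the right. *)
have [x1 [fgx1 x12 rx1 rgx1]] : exists x1, [/\ f x1 != g x1, x1 < f x1, right o x1 & ~~ right o (g x1)].
  have : exists r, [/\ f r != g r, right o r & ~~ right o (g r)].
    have fgga : f (g a) != g (g a).
      by rewrite gK; apply: contraNneq fga => H; rewrite -[X in f X]H fK.
    have [ra|ra] := boolP (right o a); first by exists a; move: Rga; rewrite ra; case: (right o (g a)).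
    by exists (g a); rewrite gK in fgga *; move: Rga; rewrite (negPf ra); case: (right o (g a)).
  case=> r [fgr rr rgr].
  have [grf _ _] := near_swap fK gK fix_fg fg fgr.
  have fgfr : f (f r) != g (f r).
    by rewrite fK; apply: contraNneq fgr => H; rewrite [X in g X]H gK.
  have fgfgr : f (g r) != g (g r).
    by rewrite gK; apply: contraNneq fgr => H; rewrite -[X in f X]H fK.
  have frr : f r != r.
    by rewrite fix_fg; apply: contraNneq rgr => ->.
  case: (ltngtP r (f r)) => [lt|gt|/val_inj/eqP]; last by rewrite eq_sym (negPf frr).
    by exists r.
  by exists (f r); split=> //; [rewrite fK | rewrite -Rf | rewrite grf -Rf].
have [] := near_swap fK gK fix_fg fg fgx1.
set x2 := f x1 in x12 *; set w1 := g x1 in rgx1 *; set w2 := f w1 => gx2 U fgE.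
have rx2 : right o x2 by rewrite -Rf.
have rw2 : ~~ right o w2.
  by rewrite /w2 -Rf // /w1 gK; apply: contraNneq fgx1 => H; rewrite -[X in f X]H fK.
have [/and4P[]] := (U, isT); rewrite !inE !negb_or => /and3P[n12 n1w1 n1w2] /andP[n2w1 n2w2] nw12 _.
have gw1 : g w1 = x1 by rewrite /w1 gK.
have gw2 : g w2 = x2 by rewrite -gx2 gK.
have memX u : (right o u && ~~ right o (g u)) = [|| u == x1, u == x2 | u \in X].
  have [|uL] := boolP (u \in [:: x1; x2; w1; w2]).
    rewrite !inE mem_crossed => /or4P[] /eqP->.
    - by rewrite rx1 -/w1 rgx1 eqxx.
    - by rewrite rx2 gx2 rw2 eqxx orbT.
    - by rewrite (negPf rgx1) ![w1 == _]eq_sym (negPf n1w1) (negPf n2w1).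
    - by rewrite (negPf rw2) ![w2 == _]eq_sym (negPf n1w2) (negPf n2w2).
  rewrite -fgE // -mem_crossed -/X; move: uL; rewrite !inE !negb_or.
  by case/and4P=> /negPf-> /negPf->.
have gs : g s = s by apply/eqP; rewrite -fix_fg fs.
have gt : g t = t by apply/eqP; rewrite -fix_fg ft.
have stN : s != t := src_neq_tgt o.
pose y1 := if b then w1 else x1; pose z1 := if b then x1 else w1.
pose y2 := if b then w2 else x2; pose z2 := if b then x2 else w2.
have [fy1 fz1] : f y1 = y2 /\ f z1 = z2 by rewrite /y1 /y2 /z1 /z2; case: (b).
have [fy2 fz2] : f y2 = y1 /\ f z2 = z1 by rewrite -fy1 -fz1 !fK.
have [gy1 gy2] : g y1 = z1 /\ g y2 = z2 by rewrite /y1 /y2 /z1 /z2; case: (b).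
have [gz1 gz2] : g z1 = y1 /\ g z2 = y2 by rewrite -gy1 -gy2 !gK.
have [y12 z12 yz12] : [/\ y1 != y2, z1 != z2 & y2 != z1].
  by rewrite /y1 /y2 /z1 /z2; split; case: (b); rewrite // eq_sym.
have y1z2 : y1 != z2 by rewrite -(can_eq fK) fy1 fz2.
have y1t : y1 != t by apply: contraNneq y12 => H; rewrite -fy1 H ft.
have y1s : y1 != s by apply: contraNneq y12 => H; rewrite -fy1 H fs.
have fgE' v : v != y1 -> v != y2 -> v != z1 -> v != z2 -> f v = g v.
  move=> v1 v2 v3 v4; apply: fgE; rewrite !inE !negb_or.
  by move: v1 v2 v3 v4; rewrite /y1 /y2 /z1 /z2; case: (b) => -> -> -> ->.
(* If nothing was met before the move, the resolution of [g] restores the arc z1 z2, and the arcs st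
   and y1 y2 become s y1 and y2 t. *)
case XE : X X1 => [|x [|//]] _.
  have X' : crossed o g = [:: x1; x2].
    by apply: crossed_eq => [|u]; rewrite /= ?x12 // memX XE !inE orbF.
  exists [:: b; ~~ b]; rewrite X' XE; split=> //.
    by rewrite !weight_cons weight_nil sgn_neg addr0 subrr.
  have -> : resolve o g [:: b; ~~ b] = join s y1 (join z1 z2 (join y2 t g)).
    by rewrite /resolve X' /= gx2 -/w1 /y1 /z1 /y2 /z2; case: (b).
  have -> : S = join s t f by rewrite /S /resolve -/X XE.
  apply: (@nearI _ _ [:: s; t; y1; y2] s) => //.
    by rewrite !joinE eqxx eq_sym.
  move=> v; rewrite !inE !negb_or => /and4P[vs vt v1 v2]; rewrite !joinE.
  rewrite (negPf vs) (negPf vt) (negPf v1) (negPf v2).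
  case: (eqVneq v z1) => [->//|vz1]; case: (eqVneq v z2) => [->//|vz2].
  exact: fgE'.
have /andP[rx rfx] : right o x && ~~ right o (f x) by rewrite -mem_crossed -/X XE mem_head.
have fgx : f x = g x.
  by apply/eqP; apply: contraLR rx => /Rf->.
pose y := if b then f x else x; pose z := if b then x else f x.
have SE : S = join s y (join z t f) by rewrite /S XE; exact: (resolve1 XE erefl erefl).
have fgy : f y = g y by rewrite /y; case: (b); rewrite // fK fgx gK.
have fgz : f z = g z by rewrite /z; case: (b); rewrite // fK fgx gK.
have fy : f y = z by rewrite /y /z; case: (b).
have yz : y != z.
  by rewrite /y /z; apply: contraNneq rfx; case: (b) => [->|<-].
have zt : z != t by rewrite -fy (inv_eq fK) ft; apply: contraNneq yz => H; rewrite -fy H ft.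
have zs : z != s by rewrite -fy (inv_eq fK) fs; apply: contraNneq yz => H; rewrite -fy H fs.
have offD u v : f u = g u -> f v != g v -> u != v by move=> H; apply: contraNneq => <-; rewrite H.
have fgy1 : f y1 != g y1 by rewrite fy1 gy1.
have fgz1 : f z1 != g z1 by rewrite fz1 gz1 eq_sym.
have fgz2 : f z2 != g z2 by rewrite fz2 gz2 eq_sym.
have x1x2F := noncrossing_right rx1 rx2 rx rfx.
have fgx2 : f x2 != g x2 by rewrite fK gx2 eq_sym eq_sym.
have xx1 : x != x1 := offD _ _ fgx fgx1.
have xx2 : x != x2 := offD _ _ fgx fgx2.
(* The arc at x is met before or after both new ones, since x does not lie between x1 and x2. *)
case: (ltngtP x x1) x1x2F => [xx1lt _|x1x|/val_inj/eqP]; last by rewrite (negPf xx1).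
  have X' : crossed o g = [:: x; x1; x2].
    apply: crossed_eq => [|u]; first by rewrite /= xx1lt x12.
    by rewrite memX XE !inE orbC -orbA.
  exists [:: b; b; ~~ b]; rewrite X' XE; split=> //.
    by rewrite !weight_cons weight_nil sgn_neg addr0 subrr addr0.
  have -> : resolve o g [:: b; b; ~~ b] = join s y (join z y1 (join z1 z2 (join y2 t g))).
    by rewrite /resolve X' /= gx2 -fgx -/w1 /y /z /y1 /z1 /y2 /z2; case: (b).
  rewrite SE; apply: (@nearI _ _ [:: z; t; y1; y2] z) => //.
    by rewrite !joinE eqxx [z == y]eq_sym (negPf yz) (negPf zs) eq_sym.
  move=> v; rewrite !inE !negb_or => /and4P[vz vt v1 v2]; rewrite !joinE.
  case: (v == s) => //; case: (v == y) => //.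
  rewrite (negPf vz) (negPf vt) (negPf v1) (negPf v2).
  case: (eqVneq v z1) => [->//|vz1]; case: (eqVneq v z2) => [->//|vz2].
  exact: fgE'.
rewrite /= => /negbT; rewrite -leqNgt leq_eqVlt => /predU1P[/val_inj/esym/eqP|x2x].
  by rewrite (negPf xx2).
have X' : crossed o g = [:: x1; x2; x].
  apply: crossed_eq => [|u]; first by rewrite /= x2x x12.
  by rewrite memX XE !inE.
exists [:: b; ~~ b; b]; rewrite X' XE; split=> //.
  by rewrite !weight_cons weight_nil sgn_neg addr0 addNr addr0.
have -> : resolve o g [:: b; ~~ b; b] = join s y1 (join z1 z2 (join y2 y (join z t g))).
  by rewrite /resolve X' /= gx2 -fgx -/w1 /y /z /y1 /z1 /y2 /z2; case: (b).
rewrite SE; apply: (@nearI _ _ [:: s; y; y1; y2] s) => //.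
  by rewrite !joinE eqxx offD.
move=> v; rewrite !inE !negb_or => /and4P[vs vy v1 v2]; rewrite !joinE.
rewrite (negPf vs) (negPf vy) (negPf v1) (negPf v2).
have z1t : z1 != t by apply: contraNneq z12 => H; rewrite -fz1 H ft.
have z2t : z2 != t by rewrite -fz1 (inv_eq fK) ft.
have z1z : z1 != z by rewrite eq_sym offD.
have z2z : z2 != z by rewrite eq_sym offD.
case: (eqVneq v z1) => [->|vz1]; first by rewrite (negPf z1z) (negPf z1t).
case: (eqVneq v z2) => [->|vz2]; first by rewrite (negPf z2z) (negPf z2t).
by do 2!case: ifP => // _; apply: fgE'.
Qed.

(** Three cases: the overstrand meets an arc of [f] changed by the move, or it meets only changed
    arcs of [g], or it meets no changed arc. *)
Lemma lift : size X <= 1 -> exists e, [/\ size e = size (crossed o g),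
   weight e = weight (nseq (size X) b) & near S (resolve o g e)].
Proof.
have fK := mf.1; have gK := mg.1.
move=> X1; have [a fga] : exists a, f a != g a.
  case/andP: fg => nfg _; apply/existsP; apply: contraR nfg; rewrite negb_exists => /forallP H.
  by apply/eqP/ffunP => u; have := H u; rewrite negbK => /eqP.
have fD u : f u != g u -> f (f u) != g (f u).
  by rewrite fK; apply: contraNneq => H; rewrite [X in g X]H gK.
have [/existsP[u /andP[Du Ru]]|] := boolP [exists u, (f u != g u) && (right o u != right o (f u))].
  have [x Xx Dx] : exists2 x, x \in X & f x != g x.
    have [ru|ru] := boolP (right o u).
      by exists u; rewrite // mem_crossed ru; move: Ru; rewrite ru; case: (right o (f u)).
    exists (f u); rewrite ?fD // mem_crossed fK ru andbT.
    by move: Ru; rewrite (negPf ru); case: (right o (f u)).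
  apply: (@lift_crossing_arc x) => //.
  by case: (X) X1 Xx => [|x' [|]] //; rewrite inE => _ /eqP->.
rewrite negb_exists => /forallP noR.
have Rf u : f u != g u -> right o u = right o (f u).
  by move=> Du; have := noR u; rewrite Du negbK => /eqP.
have [/existsP[u /andP[Du Ru]]|] := boolP [exists u, (f u != g u) && (right o u != right o (g u))].
  exact: (lift_new_crossings X1 Du Ru Rf).
rewrite negb_exists => /forallP noRg.
apply: (lift_same_crossed fga Rf) => u Du.
by have := noRg u; rewrite Du negbK => /eqP.
Qed.
End Lift.

(** * Extremal terms *)

Section SkeinTerms.
Local Open Scope ring_scope.

Lemma skein_ge0 n (os : seq 'I_n) g t : 0 <= skein os g t.
Proof.
elim: os g t => [|o os IH] g t /=; first by case: (_ && _).
by apply: sumr_ge0 => f _; apply: sumr_ge0 => e _; apply: IH.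
Qed.

(** Nonnegative coefficients do not cancel, so a term survives as soon as one sequence of choices
    produces it. *)
Lemma skein_consP n (o : 'I_n) os g t :
  skein (o :: os) g t <> 0 <->
  exists f e, [/\ size e = size (crossed o f), resolve o f e = g &
                  skein os f (t - weight e) <> 0].
Proof.
split=> [H|[f [e [se eg H]]] H0].
  have [f /eqP] : exists f : pairing n, \sum_(e : (size (crossed o f)).-tuple bool | resolve o f e == g)
      skein os f (t - weight e) != 0.
    apply/existsP; apply: contra_notT H; rewrite negb_exists => /forallP H.
    by rewrite /= big1 // => f _; apply/eqP; rewrite -[_ == _]negbK H.
  move=> Hf; have [e /andP[/eqP eg /eqP He]] : exists e : (size (crossed o f)).-tuple bool,
      (resolve o f e == g) && (skein os f (t - weight e) != 0).
    apply/existsP; apply: contra_notT Hf; rewrite negb_exists => /forallP He.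
    by rewrite big1 // => e eg; have := He e; rewrite eg /= negbK => /eqP.
  by exists f, e; rewrite size_tuple.
have se' : size e == size (crossed o f) by apply/eqP.
apply: H; move: H0 => /= /psumr_eq0P H0.
have {H0} : \sum_(e : (size (crossed o f)).-tuple bool | resolve o f e == g)
      skein os f (t - weight e) = 0.
  by apply: H0 => // h _; apply: sumr_ge0 => *; apply: skein_ge0.
move=> /psumr_eq0P H0.
by apply: (H0 _ (Tuple se')) => [*|]; [apply: skein_ge0 | apply/eqP].
Qed.

Definition endpoint n (os : seq 'I_n) (u : point n) : bool :=
  has (fun o => (u == strand_src o) || (u == strand_tgt o)) os.

Lemma strand_eq n (o o' : 'I_n) u :
  (u == strand_src o) || (u == strand_tgt o) ->
  (u == strand_src o') || (u == strand_tgt o') -> o = o'.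
Proof.
by case/orP => /eqP->; rewrite /strand_src /strand_tgt ?eq_lshift ?eq_rshift
  ?eq_lrshift ?eq_rlshift ?orbF => /eqP.
Qed.

Definition spans n (os : seq 'I_n) (f : pairing n) : Prop :=
  matching f /\ forall u, (f u == u) = ~~ endpoint os u.

Lemma spans_fix n (o : 'I_n) os f : uniq (o :: os) -> spans os f ->
  f (strand_src o) = strand_src o /\ f (strand_tgt o) = strand_tgt o.
Proof.
move=> /= /andP[oos _] [_ Ef]; split; apply/eqP; rewrite Ef;
apply: contra oos => /hasP[o' o'os H].
  by rewrite (@strand_eq _ o o' (strand_src o)) // eqxx.
by rewrite (@strand_eq _ o o' (strand_tgt o)) // eqxx orbT.
Qed.

Lemma skein_spans n (os : seq 'I_n) f t : uniq os -> skein os f t <> 0 -> spans os f.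
Proof.
elim: os f t => [|o os IH] f t U.
  move=> /=; case: eqP => [->|] //= _; split; last by move=> u; rewrite ffunE eqxx.
  by split=> [u|a b]; rewrite !ffunE // !sepxx.
case/skein_consP => g [e [se <- Hg]].
have Uos : uniq os by case/andP: U.
have sg := IH _ _ Uos Hg; have [gs gt] := spans_fix U sg; have [mg Eg] := sg.
have [mr fixr _] := resolveP mg gs gt se.
by split=> // u; rewrite fixr Eg /= -!negb_or orbC.
Qed.

(** Maximality ([b] true) or minimality ([b] false) with respect to a single split move, for any
    list of strands, so that it can be passed down to the strands below. *)
Definition extremal n (b : bool) (os : seq 'I_n) (f : pairing n) (t : int) : Prop :=
  skein os f t <> 0 /\
  forall g, skein os g (t + sgn b *+ 2) <> 0 -> ~~ near f g.

Definition all_res n (b : bool) (o : 'I_n) (f : pairing n) : pairing n :=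
  resolve o f (nseq (size (crossed o f)) b).

(* Changing one choice in the top layer is a split move changing the power by 2,
   so an extremal term makes the same choice everywhere. *)
Lemma extremal_top n b (o : 'I_n) os S t : uniq (o :: os) ->
  extremal b (o :: os) S t ->
  exists f t', [/\ spans os f, S = all_res b o f &
    (size (crossed o f) <= 1)%N -> extremal b os f t'].
Proof.
move=> U [HS ext]; have Uos : uniq os by case/andP: U.
have [f [e [se eS Hf]]] := iffLR (skein_consP _ _ _ _) HS.
have sf := skein_spans Uos Hf; have [fs ft] := spans_fix U sf; have [mf Ef] := sf.
have eE : e = nseq (size (crossed o f)) b.
  rewrite -se; apply/all_pred1P; apply: contraT => /allPn[b' b'e nb].
  have {}b'e : ~~ b \in e by case: (b) b' nb b'e => [] [].
  have [e' [se' we' ne']] := resolve_flip mf fs ft se b'e.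
  have /ext : skein (o :: os) (resolve o f e') (t + sgn b *+ 2) <> 0.
    apply/skein_consP; exists f, e'; split=> //; first by rewrite se'.
    by rewrite we' opprD addrACA subrr addr0.
  by rewrite -eS ne'.
exists f, (t - weight e); split=> //; first by rewrite /all_res -eE.
move=> X1; split=> // g Hg; apply/negP => nfg.
have sg := skein_spans Uos Hg; have [mg Eg] := sg.
have fix_fg u : (f u == u) = (g u == u) by rewrite Ef Eg.
have [e' [se' we' ne']] := lift b mf fs ft mg fix_fg nfg X1.
have /ext : skein (o :: os) (resolve o g e') (t + sgn b *+ 2) <> 0.
  apply/skein_consP; exists g, e'; split=> //.
  by rewrite we' -eE addrAC.
by rewrite -eS eE ne'.
Qed.

End SkeinTerms.

(** * Comparing all-A and all-B resolutions *)

Lemma all_res_src n b (o : 'I_n) (f : pairing n) :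
  all_res b o f (strand_src o) =
  if crossed o f is x :: _ then (if b then f x else x) else strand_tgt o.
Proof.
by rewrite /all_res /resolve; case: crossed => [|x X] /=; rewrite joinE eqxx.
Qed.

(** The last piece of the overstrand starts at x for an A-split and at [f x] for a B-split, where x
    lies on the last arc met; the default p of [last] is the case of no arc. *)
Lemma resolve_from_finish n b (f : pairing n) X p q : q != p -> q \notin X -> f q \notin X ->
  involutive f ->
  resolve_from f p q (zip X (nseq (size X) b)) q = last p (if b then X else [seq f x | x <- X]).
Proof.
move=> qp qX fqX fK; elim: X p qp qX fqX => [|x X IH] p qp /=.
  by rewrite joinE eqxx (negPf qp); case: (b).
rewrite !inE !negb_or (inv_eq fK) => /andP[qx qX] /andP[qfx fqX].
rewrite joinE (negPf qp); set y := if b then f x else x.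
have /negPf-> : q != y by rewrite /y; case: (b).
rewrite IH //; last by case: (b).
by case: (b).
Qed.

Lemma right_neq n (o : 'I_n) u : right o u -> (u != strand_src o) && (u != strand_tgt o).
Proof. by move=> ru; apply/andP; split; apply: contraTneq ru => ->; rewrite ?right_src ?right_tgt. Qed.

Lemma all_res0 n b (o : 'I_n) (f : pairing n) : crossed o f = [::] ->
  all_res b o f = join (strand_src o) (strand_tgt o) f.
Proof. by rewrite /all_res /resolve => ->. Qed.

Lemma right_strand n (o o1 : 'I_n) : o1 != o -> right o (strand_src o1) = ~~ right o (strand_tgt o1).
Proof.
rewrite /right /strand_src /strand_tgt /= -val_eqE /=; move: (ltn_ord o1) (ltn_ord o); lia.
Qed.

Lemma strand_side n (o o1 : 'I_n) u v : o1 != o ->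
  (u == strand_src o1) || (u == strand_tgt o1) ->
  (v == strand_src o1) || (v == strand_tgt o1) -> right o u = right o v -> u = v.
Proof.
by move=> o1o /orP[]/eqP-> /orP[]/eqP->; rewrite ?right_strand //; case: (right _ _).
Qed.

Lemma spans_endpoint n (os : seq 'I_n) f u : spans os f -> endpoint os u -> endpoint os (f u) /\ f u != u.
Proof.
by move=> [[fK _] Ef] Eu; rewrite -[endpoint _ _]negbK -Ef fK eq_sym Ef Eu.
Qed.

Section TwoResolutions.
Variables (n : nat) (o : 'I_n) (os : seq 'I_n).
Hypothesis U : uniq (o :: os).

Lemma all_res_tgt b f : spans os f ->
  all_res b o f (strand_tgt o) =
  last (strand_src o) (if b then crossed o f else [seq f x | x <- crossed o f]).
Proof.
move=> sf; have [fs ft] := spans_fix U sf.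
apply: resolve_from_finish; rewrite ?ft ?mem_crossed ?right_tgt //; last exact: sf.1.1.
by rewrite eq_sym src_neq_tgt.
Qed.

Lemma all_res_off b f u : spans os f -> u != strand_src o -> u != strand_tgt o ->
  u \notin crossed o f -> f u \notin crossed o f -> all_res b o f u = f u.
Proof.
move=> sf us ut uX fuX; have [fs ft] := spans_fix U sf.
by have [_ _ ->] := resolveP sf.1 fs ft (size_nseq (size (crossed o f)) b).
Qed.

Lemma all_res_spans b f : spans os f -> spans (o :: os) (all_res b o f).
Proof.
move=> sf; have [fs ft] := spans_fix U sf.
have [mr fixr _] := resolveP sf.1 fs ft (size_nseq (size (crossed o f)) b).
by split=> // u; rewrite fixr sf.2 /= -!negb_or orbC.
Qed.

Lemma crossed_of_right b f u : spans os f -> right o u -> ~~ right o (all_res b o f u) ->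
  u \in crossed o f.
Proof.
move=> sf ru; have /andP[us ut] := right_neq ru; apply: contraNT => uX.
have rfu : right o (f u) by move: uX; rewrite mem_crossed ru negbK.
by rewrite all_res_off // mem_crossed rfu sf.1.1 ru.
Qed.

Lemma all_res0_inj f g : spans os f -> spans os g ->
  join (strand_src o) (strand_tgt o) f = join (strand_src o) (strand_tgt o) g -> f = g.
Proof.
move=> sf sg /ffunP H; have [fs ft] := spans_fix U sf; have [gs gt] := spans_fix U sg.
apply/ffunP => u; have := H u; rewrite !joinE.
case: (eqVneq u (strand_src o)) => [->|_]; first by rewrite fs gs.
by case: (eqVneq u (strand_tgt o)) => [->|_]; first by rewrite ft gt.
Qed.

End TwoResolutions.

Lemma crossed_right n (o : 'I_n) (f : pairing n) x X : crossed o f = x :: X ->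
  right o x /\ ~~ right o (f x).
Proof.
by move=> E; apply/andP; rewrite -mem_crossed E mem_head.
Qed.

(** The partner of the source of O lies on the left if A-splits occur, on the right if B-splits
    occur, and is the target of O if no arc is met. So O meets no arc of either lower split, and the
    two lower splits agree. The descent stops at a single lower strand, which O must meet. *)
Lemma extremal_disjoint n (os : seq 'I_n) f t u : uniq os -> 2 <= size os ->
  extremal true os f t -> extremal false os f u -> False.
Proof.
elim: os f t u => [//|o os IH] S t u U; rewrite /= ltnS => os_gt0 E1 E2.
have [f [t' [sf Sf ef]]] := extremal_top U E1.
have [g [u' [sg Sg eg]]] := extremal_top U E2.
have [Xf Xg] : crossed o f = [::] /\ crossed o g = [::].
  have := all_res_src true o f; have := all_res_src false o g; rewrite -Sf -Sg.
  case Eg: (crossed o g) => [|y Y]; case Ef: (crossed o f) => [|x X] // -> H.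
  - have [_ rfx] := crossed_right Ef; have [fs ft] := spans_fix U sf.
    have /eqP := H; rewrite eq_sym (inv_eq sf.1.1) ft => /eqP xt.
    by have [] := crossed_right Ef; rewrite xt right_tgt.
  - by have [] := crossed_right Eg; rewrite H right_tgt.
  - by have [ry _] := crossed_right Eg; have [_] := crossed_right Ef; rewrite -H ry.
have fg : f = g.
  by apply: (all_res0_inj U sf sg); rewrite -(all_res0 true Xf) -(all_res0 false Xg) -Sf.
subst g; rewrite Xf in ef eg.
have Uos : uniq os by case/andP: U.
have [os2|] := leqP 2 (size os); first by apply: (IH _ _ _ Uos os2 (ef _) (eg _)).
case: os os_gt0 U sf {sg IH E1 E2 ef eg Uos} => [//|o1 [|//]] _ U sf _.
have o1o : o1 != o by move: U; rewrite /= inE eq_sym andbT.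
have E1 : endpoint [:: o1] (strand_src o1) by rewrite /= eqxx.
have [E2 n2] := spans_endpoint sf E1.
have r2 : right o (strand_src o1) != right o (f (strand_src o1)).
  apply: contraNneq n2 => H; apply/eqP/esym; apply: (strand_side o1o _ _ H); first by rewrite eqxx.
  by move: E2; rewrite /= orbF.
have := mem_crossed o f (strand_src o1); have := mem_crossed o f (f (strand_src o1)).
rewrite Xf !in_nil sf.1.1; move: r2.
by case: (right _ _); case: (right _ _).
Qed.

Section MixedResolutions.
Variables (n : nat) (o : 'I_n) (os : seq 'I_n) (f g : pairing n).
Hypotheses (U : uniq (o :: os)) (sf : spans os f) (sg : spans os g).
Let s := strand_src o.
Let t := strand_tgt o.

Lemma near_all_res_swap b c : near (all_res b o f) (all_res c o g) ->
  all_res b o f s != all_res c o g s ->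
  let S := all_res b o f in let T := all_res c o g in
  [/\ T (S s) = S (T s), uniq [:: s; S s; T s; S (T s)] &
      forall u, u \notin [:: s; S s; T s; S (T s)] -> S u = T u].
Proof.
move=> nST; apply: near_swap => //.
- exact: (all_res_spans U b sf).1.1.
- exact: (all_res_spans U c sg).1.1.
- by move=> u; rewrite (all_res_spans U b sf).2 (all_res_spans U c sg).2.
Qed.

(** Let S and T be the two resolutions. A split move that breaks the arc st of S gives
    [T t = S (T s)]. This point is on the same side of O as [T s], since O meets no arc of [f]; but
    [T s] and [T t] lie on different sides. *)
Lemma near_one_uncrossed b c x X : crossed o f = [::] -> crossed o g = x :: X ->
  ~~ near (all_res b o f) (all_res c o g).
Proof.
move=> Xf Xg; apply/negP => nST.
have [gs gt] := spans_fix U sg; have gK := sg.1.1; have fK := sf.1.1.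
have Ss : all_res b o f s = t by rewrite all_res_src Xf.
have Ts : all_res c o g s = if c then g x else x by rewrite all_res_src Xg.
have [rx rgx] := crossed_right Xg.
have /andP[xs xt] := right_neq rx.
have Tst : all_res c o g s != t.
  by rewrite Ts; case: (c) => //; rewrite (inv_eq gK) gt.
have Tss : all_res c o g s != s.
  by rewrite Ts; case: (c) => //; rewrite (inv_eq gK) gs.
have [|+ _ _] := near_all_res_swap nST; first by rewrite Ss eq_sym.
rewrite Ss (all_res_tgt U) // => H.
set y := all_res c o g s in Ts Tst Tss H.
have ry : right o y = ~~ c by rewrite Ts; case: (c); rewrite ?rx ?(negPf rgx).
have Xf0 v : (v \in crossed o f) = false by rewrite Xf.
have Sy : all_res b o f y = f y by rewrite (all_res_off U) // Xf0.
have rfy : right o (f y) = right o y.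
  have := Xf0 y; have := Xf0 (f y); rewrite !mem_crossed fK.
  by case: (right o y); case: (right o (f y)).
have : right o (last (strand_src o) (if c then crossed o g else [seq g x | x <- crossed o g])) = c.
  rewrite Xg; case: (c) => /=.
    have : last x X \in crossed o g by rewrite Xg mem_last.
    by rewrite mem_crossed => /andP[].
  have : last x X \in crossed o g by rewrite Xg mem_last.
  by rewrite last_map mem_crossed => /andP[_ /negPf].
by rewrite H Sy rfy ry; case: (c).
Qed.

(** S sends s to the left and t to the right, and T does the reverse, so the move involves both s
    and t, and every point on the right other than y keeps its partner. A second arc met in one
    lower split would give such a point a partner on the left, and so an arc met in the other lower
    split that cannot be there. *)
Lemma near_both_crossed x X y Y : crossed o f = x :: X -> crossed o g = y :: Y ->
  near (all_res true o f) (all_res false o g) -> f = g /\ X = [::].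
Proof.
move=> Xf Xg nST.
set S := all_res true o f; set T := all_res false o g.
have [gs gt] := spans_fix U sg; have gK := sg.1.1.
have [fs ft] := spans_fix U sf; have fK := sf.1.1.
have SK : involutive S := (all_res_spans U true sf).1.1.
have TK : involutive T := (all_res_spans U false sg).1.1.
have Ss : S s = f x by rewrite /S all_res_src Xf.
have Ts : T s = y by rewrite /T all_res_src Xg.
have St : S t = last x X by rewrite /S (all_res_tgt U) // Xf.
have Tt : T t = g (last y Y) by rewrite /T (all_res_tgt U) // Xg /= last_map.
have [rx rfx] := crossed_right Xf; have [ry rgy] := crossed_right Xg.
have rlx : right o (last x X).
  have : last x X \in crossed o f by rewrite Xf mem_last.
  by rewrite mem_crossed => /andP[].
have rly : ~~ right o (g (last y Y)).
  have : last y Y \in crossed o g by rewrite Xg mem_last.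
  by rewrite mem_crossed => /andP[].
have STs : S s != T s by rewrite Ss Ts; apply: contraNneq rfx => ->.
have [TSs UL STE] := near_all_res_swap nST STs; rewrite -/S -/T in TSs UL STE.
have tL : t \in [:: s; S s; T s; S (T s)].
  apply: contraT => /STE; rewrite St Tt => H.
  by move: rly; rewrite -H rlx.
have tST : t = S (T s).
  move: tL; rewrite !inE => /or4P[] /eqP //.
  - by move/eqP; rewrite eq_sym (negPf (src_neq_tgt o)).
  - rewrite Ss => /eqP; rewrite eq_sym (inv_eq fK) ft => /eqP xt.
    by move: rx; rewrite xt right_tgt.
  - by rewrite Ts => ty; move: ry; rewrite -ty right_tgt.
have lastX : last x X = y by rewrite -St tST SK Ts.
have lastY : g (last y Y) = f x by rewrite -Tt tST -TSs TK.
have STE0 u : right o u -> u != y -> S u = T u.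
  move=> ru uy; have /andP[us ut] := right_neq ru.
  apply: STE; rewrite -tST !inE !negb_or us ut Ss Ts uy !andbT /=.
  by apply: contraTneq ru => ->.
have ltX : {in X, forall u : point n, x < u}.
  by have := crossed_pairwise o f; rewrite Xf /= => /andP[/allP].
have ltY : {in Y, forall u : point n, y < u}.
  by have := crossed_pairwise o g; rewrite Xg /= => /andP[/allP].
have X0 : X = [::].
  (* If X were not empty, x would come before y and be joined to the left, so [g] would have an arc
     met before its first one. *)
  apply/eqP; apply: contraT; rewrite -size_eq0 -lt0n => X_gt0.
  have lx : x < y.
    by rewrite -lastX; apply: ltX; case: (X) X_gt0 => // ? ? _; rewrite /= mem_last.
  have xney : x != y by apply/eqP => xy; rewrite xy ltnn in lx.
  have Sx : ~~ right o (S x).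
    rewrite /S /all_res /resolve Xf; case: (X) X_gt0 Xf => [//|x2 X2] _ Xf' /=.
    have : x2 \in crossed o f by rewrite Xf' !inE eqxx orbT.
    rewrite !joinE mem_crossed => /andP[_].
    have /andP[/negPf-> _] := right_neq rx.
    case: (eqVneq x (f x)) => [xfx|_]; first by move: rfx; rewrite -xfx rx.
    by rewrite eqxx.
  have : x \in crossed o g.
    apply: (crossed_of_right U sg rx (b := false)).
    by rewrite -/T -(STE0 x rx xney).
  by rewrite Xg inE => /predU1P[xy|/ltY]; [move: lx; rewrite xy ltnn | rewrite ltnNge ltnW].
split=> //.
have xy : x = y by rewrite -lastX X0.
have Y0 : Y = [::].
  (* Likewise a second arc y2 of [g] would be met in [f], where y is the only right endpoint. *)
  case EY: Y => [//|y2 Y2].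
  have y2Y : y2 \in crossed o g by rewrite Xg EY !inE eqxx orbT.
  have ry2 : right o y2 by move: y2Y; rewrite mem_crossed => /andP[].
  have lt2 : y < y2 by apply: ltY; rewrite EY mem_head.
  have y2ney : y2 != y by apply/eqP => y2y; rewrite y2y ltnn in lt2.
  have gys : g y != s by rewrite (inv_eq gK) gs; have /andP[] := right_neq ry.
  have Tgy : T (g y) = y2.
    rewrite /T /all_res /resolve Xg EY /= !joinE.
    rewrite (negPf gys) eqxx.
    by case: eqP => // H; move: rgy; rewrite H ry.
  have Sy2 : S y2 = g y.
    by rewrite (STE0 y2 ry2 y2ney) -Tgy TK.
  have : y2 \in crossed o f.
    by apply: (crossed_of_right U sf ry2 (b := true)); rewrite -/S Sy2.
  by rewrite Xf X0 inE xy => /eqP y2y; move: lt2; rewrite y2y ltnn.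
have fgy : f y = g y by rewrite -xy -lastY Y0 /= xy.
apply/ffunP => u.
have [->|us] := eqVneq u s; first by rewrite fs gs.
have [->|ut] := eqVneq u t; first by rewrite ft gt.
have [->//|uy] := eqVneq u y.
have [->|ufy] := eqVneq u (f y); first by rewrite fK fgy gK.
have offS : S u = f u.
  rewrite /S (all_res_off U) // Xf X0 inE xy //.
  by rewrite (inv_eq fK).
have offT : T u = g u.
  rewrite /T (all_res_off U) // Xg Y0 inE //.
  by rewrite (inv_eq gK) -fgy.
rewrite -offS -offT; apply: STE.
by rewrite -tST Ss Ts xy !inE !negb_or us ufy uy ut.
Qed.

End MixedResolutions.

Lemma uncrossed_side n (o : 'I_n) (f : pairing n) u : involutive f -> crossed o f = [::] ->
  right o (f u) = right o u.
Proof.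
move=> fK Xf; have := mem_crossed o f u; have := mem_crossed o f (f u).
by rewrite Xf !in_nil fK; case: (right o u); case: (right o (f u)).
Qed.

(** Arcs that O does not meet stay on one side of it, and each lower strand has one end on each
    side; so the partner of an endpoint is the end of the other strand on the same side. *)
Lemma uncrossed_two n (o o1 o2 : 'I_n) f g : uniq [:: o; o1; o2] ->
  spans [:: o1; o2] f -> spans [:: o1; o2] g ->
  crossed o f = [::] -> crossed o g = [::] -> f = g.
Proof.
move=> U sf sg Xf Xg; apply/ffunP => u.
have [Eu|/negbTE Eu] := boolP (endpoint [:: o1; o2] u); last first.
  have /eqP-> : f u == u by rewrite sf.2 Eu.
  by apply/esym/eqP; rewrite sg.2 Eu.
pose on o' v := (v == strand_src (n := n) o') || (v == strand_tgt o').
have [i [j [io jo ui both]]] : exists i j, [/\ i != o, j != o, on i u &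
    forall v, endpoint [:: o1; o2] v -> on i v || on j v].
  have [o1o o2o] : o1 != o /\ o2 != o.
    by move: U; rewrite /= !inE negb_or => /and3P[/andP[? ?] _ _]; split; rewrite eq_sym.
  move: Eu; rewrite /= orbF => /orP[] H; [exists o1, o2 | exists o2, o1]; split=> // v;
  by rewrite /= orbF // orbC.
have partner h : spans [:: o1; o2] h -> crossed o h = [::] -> on j (h u).
  move=> sh Xh; have [Eh hu] := spans_endpoint sh Eu.
  case/orP: (both _ Eh) => // ih.
  by have := strand_side io ih ui (uncrossed_side u sh.1.1 Xh); move/eqP: hu.
apply: (strand_side jo (partner _ sf Xf) (partner _ sg Xg)).
by rewrite !uncrossed_side //; [apply: sg.1.1 | apply: sf.1.1].
Qed.

Lemma nearC n (f g : pairing n) : near f g = near g f.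
Proof. by rewrite /near eq_sym diffC. Qed.

(** If O meets no arc of either lower split, the move takes place below O and the induction applies;
    with two lower strands only one such split exists. If O meets arcs of both, the lower splits
    coincide, with one arc met, and would be extremal in both directions. The mixed case is
    [near_one_uncrossed]. *)
Lemma extremal_not_near n (os : seq 'I_n) S T t u : uniq os -> 3 <= size os ->
  extremal true os S t -> extremal false os T u -> ~~ near S T.
Proof.
elim: os S T t u => [//|o os IH] S T t u U; rewrite /= ltnS => os2 E1 E2.
have [f [t' [sf -> ef]]] := extremal_top U E1.
have [g [u' [sg -> eg]]] := extremal_top U E2.
have Uos : uniq os by case/andP: U.
case Xf: (crossed o f) => [|x X]; case Xg: (crossed o g) => [|y Y].
- apply/negP; rewrite !all_res0 // => nST.
  have [fs ft] := spans_fix U sf; have [gs gt] := spans_fix U sg.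
  have nfg : near f g.
    case/andP: nST => nST D; apply/andP; split; first by apply: contraNneq nST => ->.
    apply: leq_trans D; apply: subset_leq_card; apply/subsetP => v; rewrite !inE !joinE => fgv.
    have /negPf-> : v != strand_src o by apply: contraNneq fgv => ->; rewrite fs gs.
    by have /negPf-> : v != strand_tgt o by apply: contraNneq fgv => ->; rewrite ft gt.
  rewrite Xf Xg in ef eg.
  have [os3|] := leqP 3 (size os).
    exact: (negP (IH _ _ _ _ Uos os3 (ef isT) (eg isT)) nfg).
  case: os os2 U sf sg {IH E1 E2 ef eg Uos fs ft gs gt} => [|o1 [|o2 [|//]]] // _ U sf sg _.
  by move: nfg; rewrite (uncrossed_two U sf sg Xf Xg) /near eqxx.
- exact: (near_one_uncrossed U sf sg _ _ Xf Xg).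
- by rewrite nearC; exact: (near_one_uncrossed U sg sf _ _ Xg Xf).
apply/negP => nST; have [fg X0] := near_both_crossed U sf sg Xf Xg nST.
subst g; rewrite Xf X0 in ef eg.
exact: (extremal_disjoint Uos os2 (ef isT) (eg isT)).
Qed.

Lemma extremal_far n (os : seq 'I_n) S T t u : uniq os -> 3 <= size os ->
  extremal true os S t -> extremal false os T u -> 4 < diff S T.
Proof.
move=> U os3 E1 E2; rewrite ltnNge; apply: contra (extremal_not_near U os3 E1 E2) => D.
rewrite /near D andbT; apply/eqP => ST; rewrite -{}ST in E2.
exact: extremal_disjoint U (ltnW os3) E1 E2.
Qed.

(** * Splits of a full crossing *)

Lemma top_down_uniq n (h : ncrossing n) : uniq (top_down h).
Proof. by rewrite rev_uniq map_inj_uniq ?enum_uniq //; apply: perm_inj. Qed.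

Lemma size_top_down n (h : ncrossing n) : size (top_down h) = n.
Proof. by rewrite size_rev size_map size_enum_ord. Qed.

Lemma top_down_endpoint n (h : ncrossing n) u : endpoint (top_down h) u.
Proof.
have mem_td o : o \in top_down h.
  rewrite mem_rev; apply/mapP; exists (h o); rewrite ?mem_enum //.
  by rewrite permK.
apply/hasP; case: (split_ordP u) => o ->; exists o; rewrite ?mem_td //.
  by rewrite eqxx.
by rewrite eqxx orbT.
Qed.

Lemma spans_is_split n (h : ncrossing n) f : spans (top_down h) f -> is_split f.
Proof.
move=> [[fK ncf] Ef]; apply/and3P; split; apply/forallP => a.
- by apply/eqP.
- by rewrite Ef negbK top_down_endpoint.
apply/forallP => b; apply/negP => /and3P[ab bfa fafb].
have := ncf a b; rewrite !sepE ?(ltn_trans ab bfa) // ab bfa => H.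
have /esym/andP[] : true = (a < f b < f a); last by move=> _; rewrite ltnNge ltnW.
by apply: H; rewrite -val_eqE neq_ltn ?ab ?bfa ?orbT.
Qed.

Lemma is_split_matching n (f : pairing n) :
  is_split f -> matching f /\ forall u, f u != u.
Proof.
case/and3P=> /forallP fK' /forallP fN /forallP ncf'.
have fK : involutive f by move=> u; apply/eqP/fK'.
have nc (a b : point n) : a < b -> b < f a -> f a < f b -> False.
  by move=> ab bfa fafb; have /forallP/(_ b) := ncf' a; rewrite ab bfa fafb.
split=> //; split=> // a b ba bfa.
wlog afa : a ba bfa / a < f a.
  move=> W; case: (ltngtP a (f a)) => [|gt|/val_inj/eqP]; first exact: W.
    by rewrite !(sepC a) -{2 4}(fK a) W ?fK.
  by rewrite eq_sym (negPf (fN a)).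
have out (v : point n) : v != a -> v != f a -> sep a (f a) v -> sep a (f a) (f v).
  move=> va vfa; rewrite !sepE // => /andP[av vfa'].
  apply/andP; split.
    rewrite ltnNge leq_eqVlt; apply/negP => /predU1P[/val_inj fva|fva].
      by move: vfa; rewrite -fva fK eqxx.
    by apply: (nc (f v) a fva); rewrite fK.
  rewrite ltnNge leq_eqVlt; apply/negP => /predU1P[/val_inj/(can_inj fK) av'|fav].
    by move: va; rewrite av' eqxx.
  exact: (nc a v av).
apply/idP/idP; first exact: out.
have fba : f b != a by rewrite (inv_eq fK).
have fbfa : f b != f a by rewrite (can_eq fK).
by move/(out _ fba fbfa); rewrite fK.
Qed.

Lemma near_split_move n (S T : nsplit n) : near (val S) (val T) -> split_move S T.
Proof.
case: S T => f Sf [g Sg] /= nfg; rewrite /split_move /=.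
have [[fK _] fN] := is_split_matching Sf; have [[gK ncg] gN] := is_split_matching Sg.
have [a fga] : exists a, f a != g a.
  case/andP: nfg => nfg _; apply/existsP; apply: contraR nfg; rewrite negb_exists => /forallP H.
  by apply/eqP/ffunP => u; have := H u; rewrite negbK => /eqP.
have fix_fg u : (f u == u) = (g u == u) by rewrite (negPf (fN u)) (negPf (gN u)).
have [gfa U fgE] := near_swap fK gK fix_fg nfg fga.
(* The witnesses are a and [g a]: a third arc also belongs to [g], so it does not separate the ends
   of the arc of [g] from a to [g a]. *)
apply/existsP; exists a; apply/existsP; exists (g a).
move: U; rewrite /= !inE !negb_or => /and4P[/and3P[_ aga _] /andP[fg_ _] _ _].
rewrite eq_sym aga eq_sym fg_ /=; apply/and3P; split.
- apply/forallP => c; apply/implyP => cL.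
  have fgc := fgE c cL.
  move: cL; rewrite !inE !negb_or => /and4P[ca _ cga _].
  apply/eqP; rewrite /between -!/(sep _ _ _) fgc; apply: ncg; first by rewrite eq_sym.
  by rewrite eq_sym (inv_eq gK).
- by apply/forallP => x; apply/implyP => /fgE->.
- by case/andP: nfg => nfg _; rewrite eq_sym.
Qed.

(** * Counting components over F_2 *)

Section ComponentSpace.
Variable D : finType.
Implicit Types e : rel D.
Local Open Scope ring_scope.

(* Its row space consists of the functions that are constant on components. *)
Definition compmx e : 'M['F_2]_#|D| :=
  \matrix_(i, j) (connect e (enum_val i) (enum_val j))%:R.

Definition invariant_row e (v : 'rV['F_2]_#|D|) : Prop :=
  forall x y, e x y -> v 0 (enum_rank x) = v 0 (enum_rank y).

Lemma connect_invariant e v x y : invariant_row e v -> connect e x y ->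
  v 0 (enum_rank x) = v 0 (enum_rank y).
Proof.
move=> inv /connectP[p + ->]; elim: p x => //= z p IH x /andP[xz /IH <-].
exact: inv.
Qed.

Lemma sub_compmx e v : connect_sym e -> (v <= compmx e)%MS <-> invariant_row e v.
Proof.
move=> se; split=> [/submxP[u ->] x y exy|inv].
  rewrite !mxE; apply: eq_bigr => k _; rewrite !mxE !enum_rankK.
  by rewrite (same_connect_r se (connect1 exy)).
(* The vector v is the combination of the rows of the roots with the values of v there as
   coefficients. *)
pose u : 'rV['F_2]_#|D| := \row_k (if enum_val k \in fingraph.roots e then v 0 k else 0).
apply/submxP; exists u; apply/rowP => j; rewrite mxE.
pose r := enum_rank (fingraph.root e (enum_val j)).
rewrite (bigD1 r) //= !mxE enum_rankK.
have -> : fingraph.root e (enum_val j) \in fingraph.roots e by apply: roots_root.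
rewrite se (connect_root e (enum_val j)) mulr1 big1 ?addr0.
  by rewrite /r -{1}(enum_valK j); apply: connect_invariant (connect_root _ _).
move=> k kr; rewrite !mxE; case: ifP => [|_]; last by rewrite mul0r.
rewrite inE => /eqP rk.
have [ckj|_] := boolP (connect e _ _); last by rewrite mulr0.
case/eqP: kr; rewrite /r; apply: enum_val_inj; rewrite enum_rankK -{1}rk.
by apply/eqP; rewrite root_connect.
Qed.

(** The rows of the roots are the indicator functions of the components; in the columns of the roots
    they form an identity matrix. *)
Lemma rank_compmx e : connect_sym e -> \rank (compmx e) = n_comp e predT.
Proof.
move=> se; set R : pred D := [predI fingraph.roots e & predT].
pose B : 'M['F_2]_(#|R|, #|D|) :=
  \matrix_(i, j) (connect e (enum_val i) (enum_val j))%:R.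
have rootB (i : 'I_#|R|) : fingraph.root e (enum_val i) = enum_val i.
  by have /andP[/eqP] : R (enum_val i) := enum_valP i.
rewrite -[RHS]/(#|R|); have <- : \rank B = #|R|.
  apply/eqP/row_freeP; exists (\matrix_(j, i) (enum_val j == enum_val i)%:R).
  apply/matrixP => i k; rewrite !mxE (bigD1 (enum_rank (enum_val k : D))) //= !mxE enum_rankK eqxx mulr1.
  rewrite big1 ?addr0 => [|j jk]; last first.
    rewrite !mxE; case: eqP => [jk'|]; last by rewrite mulr0.
    by case/eqP: jk; rewrite -jk' enum_valK.
  by rewrite -root_connect // !rootB (inj_eq enum_val_inj).
apply/eqP; rewrite eqn_leq; apply/andP; split; apply: mxrankS; apply/row_subP => i.
  have rR : fingraph.root e (enum_val i) \in R by apply/andP; split; first exact: roots_root.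
  suff -> : row i (compmx e) = row (enum_rank_in rR (fingraph.root e (enum_val i))) B by apply: row_sub.
  apply/rowP => j; rewrite !mxE enum_rankK_in //.
  by rewrite (same_connect se (connect_root _ _)).
apply/sub_compmx => // x y exy; rewrite !mxE !enum_rankK.
by rewrite (same_connect_r se (connect1 exy)).
Qed.

Lemma compmx_sub e e' : connect_sym e -> connect_sym e' ->
  (forall x y, e' x y -> connect e x y) -> (compmx e <= compmx e')%MS.
Proof.
move=> se se' H; apply/row_subP => i; apply/sub_compmx => // x y /H exy.
by apply: connect_invariant exy; apply/(sub_compmx _ se); apply: row_sub.
Qed.

Lemma compmx_cap e1 e2 e : connect_sym e1 -> connect_sym e2 -> connect_sym e ->
  (forall x y, e x y -> connect e1 x y || connect e2 x y) ->
  (compmx e1 :&: compmx e2 <= compmx e)%MS.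
Proof.
move=> s1 s2 se H; apply/row_subP => i; apply/sub_compmx => // x y /H.
have /= := row_sub i (compmx e1 :&: compmx e2)%MS; rewrite sub_capmx => /andP[v1 v2].
by case/orP; apply: connect_invariant; apply/sub_compmx.
Qed.

(** This is the dimension formula for a sum and an intersection: invariance under [e1] or [e2]
    implies invariance under [e3], and invariance under both implies invariance under [e4]. *)
Lemma n_comp_submodular e1 e2 e3 e4 :
  connect_sym e1 -> connect_sym e2 -> connect_sym e3 -> connect_sym e4 ->
  (forall x y, e3 x y -> connect e1 x y) -> (forall x y, e3 x y -> connect e2 x y) ->
  (forall x y, e4 x y -> connect e1 x y || connect e2 x y) ->
  (n_comp e1 predT + n_comp e2 predT <= n_comp e3 predT + n_comp e4 predT)%N.
Proof.
move=> s1 s2 s3 s4 H1 H2 H4; rewrite -!rank_compmx // -mxrank_sum_cap leq_add //.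
  by rewrite mxrankS // addsmx_sub !compmx_sub.
by rewrite mxrankS // compmx_cap.
Qed.

(* In characteristic 2 the two points of a pair contribute equal terms. *)
Lemma invariant_sum (b : D -> D) (F : D -> 'F_2) : involutive b ->
  (forall x, b x != x) -> (forall x, F (b x) = F x) -> \sum_x F x = 0.
Proof.
move=> bK bN Fb.
pose lt x := (enum_rank x < enum_rank (b x))%N.
rewrite (bigID lt) /=.
have -> : \sum_(i | ~~ lt i) F i = \sum_(i | lt i) F i.
  rewrite (reindex_inj (inv_inj bK)); apply: eq_big => // x; rewrite /lt bK -leqNgt.
  by rewrite ltn_neqAle (inj_eq val_inj) (inj_eq enum_rank_inj) eq_sym bN.
by rewrite -mulr2n -mulr_natl pchar_Zp // mul0r.
Qed.

(** The product of two functions invariant under [b] is invariant, so its sum vanishes by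
    [invariant_sum]. *)
Lemma compmx_orthogonal (b : D -> D) (M1 M2 : 'M['F_2]_#|D|) : involutive b ->
  (forall x, b x != x) -> (M1 <= compmx (frel b))%MS -> (M2 <= compmx (frel b))%MS ->
  M1 *m M2^T = 0.
Proof.
move=> bK bN H1 H2; have sb : connect_sym (frel b) by apply/fconnect_sym/inv_inj.
apply/matrixP => i j; rewrite !mxE.
rewrite (reindex (@enum_rank D)) /=; last by apply: onW_bij; apply: enum_rank_bij.
apply: (invariant_sum bK bN) => x; rewrite !mxE.
have inv M k : (M <= compmx (frel b))%MS -> M k (enum_rank (b x)) = M k (enum_rank x).
  move=> HM; have /(sub_compmx _ sb)/(_ x (b x) (eqxx _)) : (row k M <= compmx (frel b))%MS.
    exact: submx_trans (row_sub _ _) HM.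
  by rewrite !mxE.
by rewrite !inv.
Qed.

Lemma n_comp_involution (b : D -> D) : involutive b -> (forall x, b x != x) ->
  (n_comp (frel b) predT * 2 = #|D|)%N.
Proof.
move=> bK bN; apply: (fcard_order_set (n := 2%N) (inv_inj bK)) => //.
apply/subsetP => x _; rewrite inE /fingraph.order; apply/eqP.
have -> : 2%N = #|pred2 x (b x)| by rewrite card2 eq_sym bN.
apply: eq_card => y.
rewrite !inE; apply/idP/idP => [/connectP[p + ->]|/pred2P[->|->]].
- elim: p x => [|z p IH] x /=; first by rewrite eqxx.
  by case/andP => /eqP <- /IH; rewrite bK orbC.
- exact: connect0.
- exact: fconnect1.
Qed.

Definition pair_rel (a b : D -> D) : rel D := fun x y => (y == a x) || (y == b x).
Definition triple_rel (a b c : D -> D) : rel D :=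
  fun x y => [|| y == a x, y == b x | y == c x].

Lemma pair_rel_sym a b : involutive a -> involutive b -> connect_sym (pair_rel a b).
Proof.
move=> aK bK; apply: sym_connect_sym => x y.
by rewrite /pair_rel ![y == _]eq_sym (inv_eq aK) (inv_eq bK).
Qed.

Lemma triple_rel_sym a b c : involutive a -> involutive b -> involutive c ->
  connect_sym (triple_rel a b c).
Proof.
move=> aK bK cK; apply: sym_connect_sym => x y.
by rewrite /triple_rel ![y == _]eq_sym (inv_eq aK) (inv_eq bK) (inv_eq cK).
Qed.

(* The triple of involutions is a 3-edge-coloured cubic graph, hence a
   triangulated closed surface with |D| triangles; this is the bound
   chi <= 2 for each of its components. *)
Lemma euler_bound (a b c : D -> D) :
  involutive a -> involutive b -> involutive c ->
  (forall x, a x != x) -> (forall x, b x != x) -> (forall x, c x != x) ->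
  (2 * (n_comp (pair_rel a b) predT + n_comp (pair_rel b c) predT
        + n_comp (pair_rel a c) predT) <= #|D| + 4 * n_comp (triple_rel a b c) predT)%N.
Proof.
move=> aK bK cK aN bN cN.
have sab := pair_rel_sym aK bK; have sbc := pair_rel_sym bK cK.
have sac := pair_rel_sym aK cK; have sabc := triple_rel_sym aK bK cK.
have sa : connect_sym (frel a) by apply/fconnect_sym/inv_inj.
have sb : connect_sym (frel b) by apply/fconnect_sym/inv_inj.
have sc : connect_sym (frel c) by apply/fconnect_sym/inv_inj.
have Hab_a : (compmx (pair_rel a b) <= compmx (frel a))%MS.
  by apply: compmx_sub => // x y /eqP<-; apply: connect1; rewrite /pair_rel eqxx.
have Hab_b : (compmx (pair_rel a b) <= compmx (frel b))%MS.
  by apply: compmx_sub => // x y /eqP<-; apply: connect1; rewrite /pair_rel eqxx orbT.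
have Hbc_b : (compmx (pair_rel b c) <= compmx (frel b))%MS.
  by apply: compmx_sub => // x y /eqP<-; apply: connect1; rewrite /pair_rel eqxx.
have Hbc_c : (compmx (pair_rel b c) <= compmx (frel c))%MS.
  by apply: compmx_sub => // x y /eqP<-; apply: connect1; rewrite /pair_rel eqxx orbT.
have Hac_a : (compmx (pair_rel a c) <= compmx (frel a))%MS.
  by apply: compmx_sub => // x y /eqP<-; apply: connect1; rewrite /pair_rel eqxx.
have Hac_c : (compmx (pair_rel a c) <= compmx (frel c))%MS.
  by apply: compmx_sub => // x y /eqP<-; apply: connect1; rewrite /pair_rel eqxx orbT.
(* The functions in this intersection and in the next are invariant under all three involutions. *)
have cap1 : (\rank (compmx (pair_rel a b) :&: compmx (pair_rel b c))
             <= n_comp (triple_rel a b c) predT)%N.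
  rewrite -(rank_compmx sabc); apply/mxrankS/compmx_cap => // x y.
  rewrite /triple_rel => /or3P[] /eqP->; apply/orP; [left|left|right];
  by apply: connect1; rewrite /pair_rel eqxx ?orbT.
have cap2 : (\rank (compmx (frel b) :&: compmx (pair_rel a c))
             <= n_comp (triple_rel a b c) predT)%N.
  rewrite -(rank_compmx sabc); apply/mxrankS/compmx_cap => // x y.
  rewrite /triple_rel => /or3P[] /eqP->; apply/orP; [right|left|right];
  by apply: connect1; rewrite /pair_rel /= ?eqxx ?orbT.
(* Each of the four products of summands has a common invariance: under b, a, b and c in turn. *)
have orth : (compmx (pair_rel a b) + compmx (pair_rel b c))%MS
            *m ((compmx (frel b) + compmx (pair_rel a c))%MS)^T = 0.
  set L1 := compmx (pair_rel a b); set L2 := compmx (pair_rel b c).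
  set M1 := compmx (frel b); set M2 := compmx (pair_rel a c).
  have all0 (A B : 'M['F_2]_#|D|) : (A <= (L1 + L2)%MS)%MS -> (B <= (M1 + M2)%MS)%MS ->
      A *m B^T = 0.
    move=> /sub_addsmxP[[u1 u2] -> /=] /sub_addsmxP[[v1 v2] -> /=].
    rewrite raddfD /= mulmxDl !mulmxDr.
    rewrite (compmx_orthogonal bK bN (M1 := u1 *m L1) (M2 := v1 *m M1)) ?mulmx_sub //.
    rewrite (compmx_orthogonal aK aN (M1 := u1 *m L1) (M2 := v2 *m M2)) ?mulmx_sub //.
    rewrite (compmx_orthogonal bK bN (M1 := u2 *m L2) (M2 := v1 *m M1)) ?mulmx_sub //.
    rewrite (compmx_orthogonal cK cN (M1 := u2 *m L2) (M2 := v2 *m M2)) ?mulmx_sub //.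
    by rewrite !addr0.
  exact: all0.
(* Orthogonal spaces have ranks of sum at most |D|, and the space for b has rank |D| / 2. *)
have := mulmx0_rank_max orth; rewrite mxrank_tr.
have := mxrank_sum_cap (compmx (pair_rel a b)) (compmx (pair_rel b c)).
have := mxrank_sum_cap (compmx (frel b)) (compmx (pair_rel a c)).
rewrite !rank_compmx //; have := n_comp_involution bK bN; lia.
Qed.
End ComponentSpace.

(** * States *)

Section Smoothings.
Variables (n : nat) (C : finType).
Implicit Types f g : C -> pairing n.

Definition smooth f (d : dart n C) : dart n C := (d.1, f d.1 d.2).

Lemma smoothK f : (forall k, involutive (f k)) -> involutive (smooth f).
Proof. by move=> fK [k x]; rewrite /smooth /= fK. Qed.

Lemma smooth_neq f : (forall k x, f k x != x) -> forall d, smooth f d != d.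
Proof. by move=> fN [k x]; rewrite /smooth xpair_eqE /= eqxx fN. Qed.

Definition same_crossing : rel (dart n C) := fun d d' => d'.1 == d.1.

Lemma same_crossing_sym : connect_sym same_crossing.
Proof. by apply: sym_connect_sym => d d'; rewrite /same_crossing eq_sym. Qed.

Lemma connect_fst (e : rel (dart n C)) d d' :
  (forall x y, e x y -> y.1 = x.1) -> connect e d d' -> d'.1 = d.1.
Proof.
by move=> He /connectP[p + ->]; elim: p d => //= z p IH d /andP[/He <- /IH].
Qed.

Lemma n_comp_same_crossing : 0 < n -> #|C| <= n_comp same_crossing predT.
Proof.
move=> n0; have nn0 : 0 < n + n by rewrite addn_gt0 n0.
pose r k := fingraph.root same_crossing (k, Ordinal nn0).
have r1 k : (r k).1 = k.
  by rewrite (connect_fst _ (connect_root same_crossing (k, Ordinal nn0))) // => x y /eqP.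
have r_inj : injective r by move=> k k' /(congr1 fst); rewrite !r1.
rewrite -(card_codom r_inj); apply: subset_leq_card; apply/subsetP => d /codomP[k ->].
by apply/andP; split=> //; apply: roots_root same_crossing_sym _.
Qed.

(** A dart counts twice where [f] and [g] agree. A component then has weight at least 4: two darts
    counted twice, or at least four darts. A crossing has total weight 4n - diff < 4n - 4, hence
    fewer than n - 1 components. *)
Lemma n_comp_smoothings f g : (forall k, involutive (f k)) -> (forall k, involutive (g k)) ->
  (forall k x, f k x != x) -> (forall k x, g k x != x) ->
  (forall k, 4 < diff (f k) (g k)) ->
  n_comp (pair_rel (smooth f) (smooth g)) predT <= (n - 2) * #|C|.
Proof.
move=> fK gK fN gN far; set e := pair_rel _ _.
have se : connect_sym e by apply: pair_rel_sym; apply: smoothK.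
have e1 x y : e x y -> y.1 = x.1 by case/orP => /eqP->.
pose w (d : dart n C) := if f d.1 d.2 == g d.1 d.2 then 2 else 1.
have w_gt0 d : 0 < w d by rewrite /w; case: ifP.
have class4 r : 4 <= \sum_(d | connect e r d) w d.
  have cf d : connect e r d -> connect e r (smooth f d).
    by move=> c; apply: connect_trans c (connect1 _); rewrite /e /pair_rel eqxx.
  have cg d : connect e r d -> connect e r (smooth g d).
    by move=> c; apply: connect_trans c (connect1 _); rewrite /e /pair_rel eqxx orbT.
  have sfN d : smooth f d != d := smooth_neq fN d.
  have sgN d : smooth g d != d := smooth_neq gN d.
  have sfK := smoothK fK; have sgK := smoothK gK.
  rewrite (bigD1 r) ?connect0 //= (bigD1 (smooth f r)) ?cf ?connect0 ?sfN //=.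
  have [fg|nfg] := eqVneq (f r.1 r.2) (g r.1 r.2).
    have wr : w r = 2 by rewrite /w fg eqxx.
    have wfr : w (smooth f r) = 2 by rewrite /w /smooth /= fK fg gK eqxx.
    by rewrite wr wfr; lia.
  have gfr : smooth g r != smooth f r by rewrite /smooth xpair_eqE eqxx eq_sym.
  have fgr : smooth f (smooth g r) != r by rewrite (inv_eq sfK).
  rewrite (bigD1 (smooth g r)) ?cg ?connect0 ?sgN ?gfr //=.
  rewrite (bigD1 (smooth f (smooth g r))) /=; last first.
    by rewrite cf ?cg ?connect0 ?fgr ?(can_eq sfK) ?sgN ?sfN.
  by have := w_gt0 r; have := w_gt0 (smooth f r); have := w_gt0 (smooth g r);
     have := w_gt0 (smooth f (smooth g r)); lia.
have count k : \sum_(d | fingraph.roots e d && (d.1 == k)) 1 <= n - 2.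
  have H1 : 4 * \sum_(d | fingraph.roots e d && (d.1 == k)) 1 <= \sum_(d | d.1 == k) w d.
    rewrite big_distrr /= [leqRHS](partition_big (fingraph.root e)
      (fun r => fingraph.roots e r && (r.1 == k))) /=; last first.
      by move=> d /eqP<-; rewrite (roots_root se) (connect_fst e1 (connect_root _ _)) eqxx.
    apply: leq_sum => r /andP[rr /eqP rk]; apply: leq_trans (class4 r) _.
    rewrite (eq_bigl (fun d => (d.1 == k) && (fingraph.root e d == r))) // => d.
    have -> : (fingraph.root e d == r) = connect e r d.
      by rewrite -{1}(eqP rr) root_connect // se.
    have [c|] := boolP (connect e r d); last by rewrite andbF.
    by rewrite (connect_fst e1 c) rk eqxx.
  have H2 : \sum_(d : dart n C | d.1 == k) w d + diff (f k) (g k) = 4 * n.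
    have -> : \sum_(d : dart n C | d.1 == k) w d
        = \sum_(i | i == k) \sum_(x : point n) w (i, x).
      by rewrite pair_big /=; apply: eq_big => [[i x]|[i x] _] //=; rewrite andbT.
    rewrite big_pred1_eq /diff -sum1_card [X in _ + X]big_mkcond -big_split /=.
    rewrite (eq_bigr (fun=> 2)) => [|x _]; first by rewrite sum_nat_const card_ord; lia.
    by rewrite /w inE /=; case: eqP.
  move: H1 H2 (far k); move: (\sum_(d | _ && _) 1) (\sum_(d | _) w d) (diff _ _); lia.
rewrite /n_comp_mem -sum1_card (partition_big (fun d => d.1) predT) //=.
rewrite mulnC -sum_nat_const; apply: leq_sum => k _.
rewrite (eq_bigl (fun d => fingraph.roots e d && (d.1 == k))); first exact: count.
by move=> d; rewrite !inE andbT.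
Qed.
End Smoothings.

(** * High and low splits, and the bound on circles *)

Lemma high_split_extremal n (h : ncrossing n) S : high_split h S ->
  exists t, extremal true (top_down h) (val S) t.
Proof.
case=> t [HS noT]; exists t; split=> // g Hg; apply/negP => nSg.
have Sg := spans_is_split (skein_spans (top_down_uniq h) Hg).
apply: noT; exists (exist _ g Sg, t + sgn true *+ 2)%R; apply: t_step; split=> //.
  exact: near_split_move.
by rewrite /= addrK.
Qed.

Lemma low_split_extremal n (h : ncrossing n) S : low_split h S ->
  exists t, extremal false (top_down h) (val S) t.
Proof.
case=> t [HS noT]; exists t; split=> // g Hg; apply/negP => nSg.
have Sg := spans_is_split (skein_spans (top_down_uniq h) Hg).
apply: noT; exists (exist _ g Sg, t + sgn false *+ 2)%R; apply: t_step; split=> //.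
by apply: near_split_move; rewrite nearC.
Qed.

Theorem theorem3p1 (n : nat) (hn : 3 <= n) (K : projection n)
    (hK : connected K) (smax smin : crossing K -> nsplit n * int)
    (hmax : maximal_state smax) (hmin : minimal_state smin) :
  circles smax + circles smin <= (2 * n - 4) * #|crossing K| + 2.
Proof.
have [_ high _] := hmax; have [_ low _] := hmin.
pose f k := val (smax k).1; pose g k := val (smin k).1.
have fP k := is_split_matching (valP (smax k).1).
have gP k := is_split_matching (valP (smin k).1).
have fK k : involutive (f k) := (fP k).1.1; have gK k : involutive (g k) := (gP k).1.1.
have fN k x : f k x != x := (fP k).2 x; have gN k x : g k x != x := (gP k).2 x.
have far k : 4 < diff (f k) (g k).
  have [t E1] := high_split_extremal (high k); have [u E2] := low_split_extremal (low k).
  by apply: extremal_far E1 E2; rewrite ?top_down_uniq ?size_top_down.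
have aK := @edgeK n K; have aN := @edge_neq n K.
have bK := smoothK fK; have cK := smoothK gK.
(* The three pairs of involutions give the circles of [smax], the circles of [smin] and the curves
   of the unions of splits. *)
have := euler_bound bK aK cK (smooth_neq fN) aN (smooth_neq gN).
have := n_comp_smoothings fK gK fN gN far.
have := n_comp_same_crossing (crossing K) (ltnW (ltnW hn)).
have sb := triple_rel_sym bK aK cK.
have smap : connect_sym (map_adj (@edge n K)).
  apply: sym_connect_sym => d d'.
  by rewrite /map_adj [d == _]eq_sym (inv_eq aK) [d.1 == _]eq_sym [d' == _]eq_sym.
(* Edges and moves within a crossing generate the components of the projection, while each curve of
   a union of splits lies in one component of the triple and in one crossing. *)
have smod : n_comp (triple_rel (smooth f) (@edge n K) (smooth g)) predT
      + n_comp (@same_crossing n (crossing K)) predT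
    <= n_comp (pair_rel (smooth f) (smooth g)) predT + n_comp (map_adj (@edge n K)) predT.
  apply: n_comp_submodular => //.
  - exact: same_crossing_sym.
  - exact: pair_rel_sym.
  - move=> x y; rewrite /pair_rel => /orP[]/eqP->; apply: connect1; rewrite /triple_rel eqxx ?orbT //.
  - by move=> x y; rewrite /pair_rel => /orP[]/eqP->; apply: connect1; rewrite /same_crossing.
  - move=> x y /orP[/eqP->|xy]; apply/orP; [left|right]; apply: connect1 => //.
    by rewrite /triple_rel eqxx orbT.
(* Free circles count once in each state, so twice this equation supplies the summand 2 of the
   bound. *)
have free : n_comp (map_adj (@edge n K)) predT + free_circles K = 1 := hK.
have cmax : n_comp (state_adj smax) predT = n_comp (pair_rel (smooth f) (@edge n K)) predT.
  by apply: eq_n_comp; apply: eq_connect => d d'; rewrite /state_adj /pair_rel orbC.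
have cmin : n_comp (state_adj smin) predT = n_comp (pair_rel (@edge n K) (smooth g)) predT.
  by apply: eq_n_comp; apply: eq_connect => d d'; rewrite /state_adj /pair_rel.
rewrite /circles cmax cmin card_prod card_ord; move: smod free.
have -> : (2 * n - 4) * #|crossing K| = 2 * ((n - 2) * #|crossing K|).
  by rewrite mulnA mulnBr.
have -> : #|crossing K| * (n + n) = 2 * ((n - 2) * #|crossing K|) + 4 * #|crossing K|.
  rewrite mulnA -mulnDl mulnBr; lia.
set m := (n - 2) * _; lia.
Qed.
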